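(* Let $\mathbb{F}$ be a field of characteristic zero. Let $P(\mathbf{x})\in\mathbb{F}[x_1,\dots,x_n]$ be a nonzero polynomial of degree $r$, and let $Q(\mathbf{x}, \mathbf{y})\in\mathbb{F}[x_1,\dots,x_n,y_1,\dots,y_m]$ be a polynomial such that \[ P(\mathbf{x}) = \sum_{\mathbf{y} \in \{0,1\}^m} Q(\mathbf{x}, \mathbf{y}) \] and $Q$ can be computed by an arithmetic circuit of size $s$. Let $f$ be an irreducible factor of $P$ of degree $d$. Then there exist $m' \leq \mathrm{poly}(s, r, d, n, m)$ and a polynomial $h(x_1,\dots,x_n, z_1,\dots, z_{m'})$ computable by an arithmetic circuit of size at most $s' \leq \mathrm{poly}(s, r, d, n, m)$ such that \[ f(\mathbf{x}) = \sum_{\mathbf{z} \in \{0,1\}^{m'}} h(\mathbf{x}, \mathbf{z}). \] Here $\mathrm{poly}$ denotes a fixed polynomial independent of the parameters.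
   Context: An arithmetic circuit is a directed acyclic graph whose in-degree-zero nodes are labeled by field elements or variables and whose internal nodes are sum or product gates; its size is the number of wires. *)

(* Defs.v *)
From HB Require Import structures.
From mathcomp Require Export all_boot all_order all_algebra.
From mathcomp Require Export mpoly.

Set Implicit Arguments.
Unset Strict Implicit.
Unset Printing Implicit Defensive.

Import GRing.Theory.
Local Open Scope ring_scope.

Inductive gate (F : Type) (n : nat) : Type :=
  | GConst of F
  | GVar of 'I_n
  | GSum
  | GProd.

Arguments GSum {F n}.
Arguments GProd {F n}.

Definition is_input (F : Type) (n : nat) (g : gate F n) : bool :=
  match g with GConst _ | GVar _ => true | GSum | GProd => false end.

(* Wires form a separate finite type, so that parallel wires are allowed: a   *)
(* product gate fed twice by the same node squares it, and both wires count   *)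
(* in the size. Fan-in and fan-out are unbounded.                             *)
Record circuit (F : Type) (n : nat) : Type := Circuit {
  node : finType;
  wire : finType;
  src : wire -> node;
  tgt : wire -> node;
  lab : node -> gate F n;
  out : node;
  labP : forall u : node, is_input (lab u) = [forall w : wire, tgt w != u];
  acyclicP : forall w : wire,
    ~~ connect (fun u v => [exists w', (src w' == u) && (tgt w' == v)])
         (tgt w) (src w)
}.

Arguments src {F n} c _.
Arguments tgt {F n} c _.
Arguments lab {F n} c _.
Arguments out {F n} c.

Definition circuit_size (F : Type) (n : nat) (C : circuit F n) : nat :=
  #|wire C|.

Definition gate_value (F : fieldType) (n : nat) (C : circuit F n)
    (val : node C -> {mpoly F[n]}) (u : node C) : {mpoly F[n]} :=
  match lab C u with
  | GConst c => c%:MP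
  | GVar i => 'X_i
  | GSum => \sum_(w : wire C | tgt C w == u) val (src C w)
  | GProd => \prod_(w : wire C | tgt C w == u) val (src C w)
  end.

(* By acyclicity there is exactly one such [val]; see [circuit_valuation].    *)
Definition valuation (F : fieldType) (n : nat) (C : circuit F n)
    (val : node C -> {mpoly F[n]}) : Prop :=
  forall u : node C, val u = gate_value val u.

Definition computes (F : fieldType) (n : nat) (C : circuit F n)
    (p : {mpoly F[n]}) : Prop :=
  exists2 val : node C -> {mpoly F[n]}, valuation val & val (out C) = p.

(* Q(x, y): the last m variables are replaced by the bits of y.               *)
Definition subst_bits (F : fieldType) (n m : nat) (Q : {mpoly F[n + m]})
    (y : {ffun 'I_m -> bool}) : {mpoly F[n]} :=
  Q \mPo [tuple match split i with
                | inl j => 'X_j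
                | inr k => (y k)%:R
                end | i < n + m].

Definition irreducible_elt (R : idomainType) (f : R) : Prop :=
  [/\ f != 0, f \isn't a GRing.unit
    & forall a b : R, f = a * b ->
        (a \is a GRing.unit) \/ (b \is a GRing.unit)].

Lemma eq_gate_value (F : fieldType) (n : nat) (C : circuit F n)
    (v1 v2 : node C -> {mpoly F[n]}) (u : node C) :
  (forall w, tgt C w = u -> v1 (src C w) = v2 (src C w)) ->
  gate_value v1 u = gate_value v2 u.
Proof.
by move=> h; rewrite /gate_value; case: (lab C u) => //; apply: eq_bigr => w /eqP/h.
Qed.

Lemma circuit_valuation (F : fieldType) (n : nat) (C : circuit F n) :
  exists2 val : node C -> {mpoly F[n]}, valuation val &
    forall val', valuation val' -> val' =1 val.
Proof.
pose e (u v : node C) := [exists w, (src C w == u) && (tgt C w == v)].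
pose anc u := [set v | connect e v u].
have anc_lt w : (#|anc (src C w)| < #|anc (tgt C w)|)%N.
  have esw : e (src C w) (tgt C w) by apply/existsP; exists w; rewrite !eqxx.
  apply: proper_card; apply/properP; split.
    apply/subsetP=> v; rewrite !inE => hv.
    exact: connect_trans hv (connect1 esw).
  by exists (tgt C w); rewrite !inE ?connect0 //; exact: acyclicP.
pose it k := iter k (@gate_value F n C) (fun=> 0).
have stab k l u : (#|anc u| <= k)%N -> (#|anc u| <= l)%N -> it k u = it l u.
  have pos v : (#|anc v| <= 0)%N = false.
    apply/negbTE; rewrite -ltnNge; apply/card_gt0P.
    by exists v; rewrite inE connect0.
  elim: k l u => [|k IHk] [|l] u; rewrite ?pos // => hk hl.
  rewrite /it !iterS; apply: eq_gate_value => w wu.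
  have := anc_lt w; rewrite wu => lt_wu.
  by apply: IHk; rewrite -ltnS; apply: leq_trans lt_wu _.
have le_it u : (#|anc u| <= #|node C|)%N by exact: max_card.
exists (it #|node C|) => [u | v hv u].
  by rewrite (stab #|node C| #|node C|.+1) // (leq_trans (le_it u)).
suff H k x : (#|anc x| <= k)%N -> v x = it k x by exact: H.
elim: k x => [|k IHk] x hx.
  move: hx; rewrite leqn0 => /eqP/cards0_eq/setP/(_ x).
  by rewrite !inE connect0.
rewrite hv /it iterS; apply: eq_gate_value => w wx; apply: IHk.
by rewrite -ltnS (leq_trans _ hx) // -wx.
Qed.

(* Main.v *)
(* Write P = f^(e+1) g with f not dividing g. As f is prime, on a generic line *)
(* a + y v the restrictions f0, g0 of f and g are coprime, deg f0 = d and      *)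
(* f(a) != 0. Restrict to the planes a + t b + y v and let P0 := P(a + y v).   *)
(* Modulo t^(d+1), the logarithm of P/P0 is (e+1) log (f/f0) + log (g/g0), and *)
(* these two terms have partial fraction denominators f0^k and g0^k; hence a   *)
(* fixed linear functional of the coefficients of log (P/P0) extracts          *)
(* log (f/f0) at y = 0, and exponentiating gives f(a + t b). As every linear   *)
(* functional on polynomials of bounded degree is a combination of evaluations *)
(* at integers, this yields constants such that                                *)
(*   f(a + x) = sum_t w_t sum_(l <= d) k_l                                     *)
(*     (sum_k sum_(j < d) nu_kj (P(a + t x + k v) - c_k)^(j+1))^l.             *)
(* Boolean sums of small circuits are closed under affine substitutions, sums  *)
(* and products, so this formula turns such a sum for P into one for f.        *)

From HB Require Import structures.
Require Import Defs.
From mathcomp Require Import all_boot all_order all_algebra mpoly ring.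
From Stdlib Require Import Classical_Prop.

Set Implicit Arguments.
Unset Strict Implicit.
Unset Printing Implicit Defensive.

Import GRing.Theory.
Local Open Scope ring_scope.

(** Boolean sums of small circuits are closed under addition, multiplication and affine substitution
    ([vsumD], [vsumM], [vsum_affine]), but a product adds up the numbers of bits. It therefore
    suffices to express f through P by polynomially many terms in which powers have exponent at most
    d. [factor_formula] is such an expression: it nests two powers, which leads to the [d * (d * m)]
    bits of [vsum_factor].

    The logarithm turns P = f^(e+1) g into a sum whose two terms can be separated linearly. With
    denominators cleared ([hlogM], [hlogX]), each coefficient in t of the g-term is a multiple of
    f0^(d(e+1)), and that of the f-term is g0^d times a polynomial of smaller y-degree than
    f0^(d(e+1)). Once f0 and g0 are coprime, a linear functional kills the former and reads the
    latter at y = 0 ([factor_functional], [factor_log]); [hexp_hlog] then undoes the logarithm.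
    Coprimality on a line holds because f is prime ([mpoly_irr_prime]) and hence satisfies a Bezout
    relation with g ([prime_bezout], [generic_line]).

    Characteristic zero provides the inverses of the integers j and e+1, the interpolation nodes,
    points where a nonzero polynomial does not vanish, and division by 2^m. *)

Lemma mpoly_rmorph_eq (n : nat) (R : comNzRingType) (S : nzRingType)
    (phi psi : {rmorphism {mpoly R[n]} -> S}) :
  (forall c, phi c%:MP = psi c%:MP) -> (forall i, phi 'X_i = psi 'X_i) ->
  phi =1 psi.
Proof.
move=> eqC eqX p; rewrite (mpolyE p) !rmorph_sum; apply: eq_bigr => m _.
rewrite -mul_mpolyC !rmorphM eqC mpolyXE_id !rmorph_prod; congr (_ * _).
by apply: eq_bigr => i _; rewrite !rmorphXn eqX.
Qed.

Lemma comp_mpolyA (n k l : nat) (R : comNzRingType) (p : {mpoly R[n]})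
    (q : n.-tuple {mpoly R[k]}) (w : k.-tuple {mpoly R[l]}) :
  (p \mPo q) \mPo w = p \mPo [tuple tnth q i \mPo w | i < n].
Proof.
pose phi := comp_mpoly w \o comp_mpoly q.
apply: (@mpoly_rmorph_eq _ _ _ phi) => [c|i] /=; first by rewrite !comp_mpolyC.
by rewrite !comp_mpolyXU -!tnth_nth tnth_mktuple.
Qed.

(** * Circuits *)

Lemma acyclic_of_rank (V W : finType) (s t : W -> V) (rk : V -> nat) :
  (forall w, (rk (s w) < rk (t w))%N) ->
  forall w, ~~ connect (fun u v => [exists w', (s w' == u) && (t w' == v)])
              (t w) (s w).
Proof.
move=> rkP w; apply/negP => /connectP[p].
suff H u : path (fun u v => [exists w', (s w' == u) && (t w' == v)]) u p ->
    (rk u <= rk (last u p))%N.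
  by move=> /H le_p E; move: (rkP w); rewrite ltnNge E le_p.
elim: p u => //= v p IHp u /andP[/existsP[w' /andP[/eqP<- /eqP<-]] /IHp].
by apply: leq_trans; exact: ltnW.
Qed.

(** The number of ancestors of a node grows strictly along a wire, by acyclicity. Ranks are easier
    to combine than reachability when circuits are composed. *)
Lemma circuit_rank (F : Type) (n : nat) (C : circuit F n) :
  exists rk : node C -> nat, forall w, (rk (src C w) < rk (tgt C w))%N.
Proof.
pose e (u v : node C) := [exists w, (src C w == u) && (tgt C w == v)].
exists (fun u => #|[set v | connect e v u]|) => w.
have esw : e (src C w) (tgt C w) by apply/existsP; exists w; rewrite !eqxx.
apply: proper_card; apply/properP; split.
  apply/subsetP=> v; rewrite !inE => hv.
  exact: connect_trans hv (connect1 esw).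
by exists (tgt C w); rewrite !inE ?connect0 //; exact: acyclicP.
Qed.

Definition csize (F : fieldType) (n : nat) (p : {mpoly F[n]}) (s : nat) : Prop :=
  exists2 C : circuit F n, computes C p & (circuit_size C <= s)%N.

Section Composition.

Variables (F : fieldType) (n k : nat).
Variables (C : circuit F n) (D : 'I_n -> circuit F k).

Let cnode : finType := (node C + {i : 'I_n & node (D i)})%type.
Let cwire : finType := (wire C + {i : 'I_n & wire (D i)})%type.

(* Wires leaving a node labelled by a variable are redirected to the circuit  *)
(* substituted for it: the number of such nodes is not controlled by the size. *)
Let redirect (u : node C) : cnode :=
  match lab C u with
  | GVar i => inr (existT _ i (out (D i)))
  | _ => inl u
  end.

Let csrc (w : cwire) : cnode :=
  match w with
  | inl w => redirect (src C w)
  | inr (existT i w) => inr (existT _ i (src (D i) w))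
  end.

Let ctgt (w : cwire) : cnode :=
  match w with
  | inl w => inl (tgt C w)
  | inr (existT i w) => inr (existT _ i (tgt (D i) w))
  end.

(** Since [redirect] bypasses the variable nodes of [C], they remain as isolated inputs, labelled
    0. *)
Let clab (u : cnode) : gate F k :=
  match u with
  | inl u => match lab C u with
             | GConst c => GConst _ c
             | GVar _ => GConst _ 0
             | GSum => GSum
             | GProd => GProd
             end
  | inr (existT i u) => lab (D i) u
  end.

Let clabP u : is_input (clab u) = [forall w, ctgt w != u].
Proof.
case: u => [u|[i u]] /=.
  transitivity (is_input (lab C u)); first by case: (lab C u).
  rewrite labP; apply/forallP/forallP => [H [w|[j w]] //|H w]; first exact: (H w).
  exact: (H (inl w)).
rewrite labP; apply/forallP/forallP => [H [w|[j w]] //|H w]; last first.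
  apply: contraNneq (H (inr (existT _ i w))) => <- /=; exact: eqxx.
apply/eqP => -[] eij; case: _ / eij u H => u H /eqP.
by rewrite eq_Tagged /=; exact/negP.
Qed.

Let cacyclic w :
  ~~ connect (fun u v => [exists w', (csrc w' == u) && (ctgt w' == v)])
         (ctgt w) (csrc w).
Proof.
have [rC rCP] := circuit_rank C.
have /fin_all_exists[rD rDP] i := circuit_rank (D i).
(* [M] bounds the ranks in all the circuits [D i]; shifting the ranks of [C] by [M.+1] places [C]
   above them. *)
pose M := (\max_(i < n) \max_(u : node (D i)) rD i u)%N.
have leM i u : (rD i u <= M)%N.
  by apply: (bigmax_sup i) => //; exact: (bigmax_sup u).
pose rk (u : cnode) := match u with
  | inl u => (M.+1 + rC u)%N | inr (existT i u) => rD i u end.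
apply: (@acyclic_of_rank cnode cwire csrc ctgt rk) => {w} -[w|[i w]] /=; last exact: rDP.
rewrite /redirect; case: (lab C _) => [c|i||] /=; rewrite ?ltn_add2l ?rCP //.
by rewrite addSn ltnS (leq_trans (leM _ _)) ?leq_addr.
Qed.

Definition circuit_comp : circuit F k :=
  @Circuit F k cnode cwire csrc ctgt clab (redirect (out C)) clabP cacyclic.

(** Redirection adds no wire, and each [D i] is present once and shared by all nodes carrying its
    variable; so sizes add instead of multiplying. *)
Lemma circuit_size_comp :
  circuit_size circuit_comp = (circuit_size C + \sum_i circuit_size (D i))%N.
Proof. by rewrite /circuit_size /= card_sum card_tagged sumnE big_map big_enum. Qed.

Let big_ctgt_inr (T : Type) (idx : T) (op : Monoid.com_law idx)
    (G : cwire -> T) i (u : node (D i)) :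
  \big[op/idx]_(w : cwire | ctgt w == inr (existT _ i u)) G w =
  \big[op/idx]_(w : wire (D i) | tgt (D i) w == u) G (inr (existT _ i w)).
Proof.
rewrite big_sumType /= big_pred0 // Monoid.mul1m.
pose Q j (w : wire (D j)) :=
  (existT (fun j => node (D j)) j (tgt (D j) w) == existT _ i u).
transitivity (\big[op/idx]_(j < n) \big[op/idx]_(w : wire (D j) | Q j w)
    G (inr (existT _ j w))).
  by rewrite sig_big_dep /=; apply: eq_big => [[j w]|[j w] _].
rewrite (bigD1 i) //= [X in op _ X]big1 ?Monoid.mulm1 => [|j ji].
  by apply: eq_bigl => w; rewrite /Q eq_Tagged.
by apply: big_pred0 => w; apply: contraNF ji => /eqP/(congr1 tag) /= ->.
Qed.

Let big_ctgt_inl (T : Type) (idx : T) (op : Monoid.com_law idx)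
    (G : cwire -> T) (u : node C) :
  \big[op/idx]_(w : cwire | ctgt w == inl u) G w =
  \big[op/idx]_(w : wire C | tgt C w == u) G (inl w).
Proof.
by rewrite big_sumType /= [X in op _ X]big_pred0 ?Monoid.mulm1 // => -[].
Qed.

Lemma computes_comp (p : {mpoly F[n]}) (q : n.-tuple {mpoly F[k]}) :
  computes C p -> (forall i, computes (D i) (tnth q i)) ->
  computes circuit_comp (p \mPo q).
Proof.
move=> [vC vCP <-] /fin_all_exists2[vD vDP vDq].
pose v (u : node circuit_comp) : {mpoly F[k]} := match u with
  | inl u => if lab C u is GVar _ then 0 else vC u \mPo q
  | inr (existT i u) => vD i u end.
have vR u : v (redirect u) = vC u \mPo q.
  rewrite /redirect; case E: (lab C u) => [c|i||]; rewrite /= ?E //.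
  by rewrite vDq (vCP u) /gate_value E comp_mpolyXU -tnth_nth.
exists v; last exact: vR.
case=> [u|[i u]]; rewrite /gate_value /=; last first.
  by rewrite (vDP i u) /gate_value !big_ctgt_inr.
rewrite !big_ctgt_inl (vCP u) /gate_value.
case: (lab C u) => [c|i||]; rewrite ?comp_mpolyC //.
  by rewrite rmorph_sum; apply: eq_bigr => w _; exact/esym/vR.
by rewrite rmorph_prod; apply: eq_bigr => w _; exact/esym/vR.
Qed.

End Composition.

Section CircuitSize.

Variables (F : fieldType).

Lemma csize_leq n (p : {mpoly F[n]}) s t : (s <= t)%N -> csize p s -> csize p t.
Proof. by move=> le_st [C CP le_s]; exists C => //; exact: leq_trans le_st. Qed.

Lemma csize_comp n k (p : {mpoly F[n]}) (q : n.-tuple {mpoly F[k]}) s t :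
  csize p s -> (forall i, csize (tnth q i) (t i)) ->
  csize (p \mPo q) (s + \sum_i t i).
Proof.
move=> [C Cp le_s] /fin_all_exists2[D Dq le_t].
exists (circuit_comp C D); first exact: computes_comp.
by rewrite circuit_size_comp leq_add // leq_sum.
Qed.

Section Input.

Variables (n : nat) (g : gate F n).
Hypothesis g_input : is_input g.

Let input_labP u : is_input g = [forall w : void, (of_void unit w : unit) != u].
Proof. by rewrite g_input; apply/esym/forallP; case. Qed.

Let input_acyclic (w : void) :
  ~~ connect (fun u v =>
         [exists w', (of_void unit w' == u) && (of_void unit w' == v)])
         (of_void unit w) (of_void unit w).
Proof. by case: w. Qed.

Definition input_circuit : circuit F n :=
  @Circuit F n unit void _ _ (fun=> g) tt input_labP input_acyclic.

End Input.

Lemma csizeC n c : csize (c%:MP : {mpoly F[n]}) 0.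
Proof.
exists (input_circuit (isT : is_input (GConst n c))); first by exists (fun=> c%:MP).
by rewrite /circuit_size card_void.
Qed.

Lemma csizeX n i : csize ('X_i : {mpoly F[n]}) 0.
Proof.
exists (input_circuit (isT : is_input (GVar F i))); first by exists (fun=> 'X_i).
by rewrite /circuit_size card_void.
Qed.

Section Binary.

Variables (g : gate F 2).
Hypothesis g_gate : ~~ is_input g.

Let blab (u : option bool) : gate F 2 :=
  if u is Some b then GVar F (if b then ord_max else ord0) else g.

Let binary_labP u : is_input (blab u) = [forall w : bool, None != u].
Proof.
case: u => [b|] /=; first by apply/esym/forallP.
by rewrite (negPf g_gate); apply/esym/forallP => /(_ true).
Qed.

Let binary_acyclic (w : bool) :
  ~~ connect (fun u v : option bool =>
         [exists w' : bool, (Some w' == u) && (None == v)])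
       None (Some w).
Proof.
by apply: (@acyclic_of_rank _ _ (@Some bool) (fun=> None)
  (fun u => if u is None then 1%N else 0%N) _ w).
Qed.

Definition binary_circuit : circuit F 2 :=
  @Circuit F 2 (option bool) bool (@Some bool) (fun=> None) blab None
    binary_labP binary_acyclic.

End Binary.

(** General sums and products are obtained by substituting into two-wire circuits for x + y and x y,
    hence the cost 2 of each operation. *)
Lemma csizeD2 : csize ('X_ord0 + 'X_ord_max : {mpoly F[2]}) 2.
Proof.
exists (binary_circuit (isT : ~~ is_input GSum)); last first.
  by rewrite /circuit_size card_bool.
pose x b : {mpoly F[2]} := 'X_(if b then ord_max else ord0).
exists (fun u => if u is Some b then x b else x false + x true) => //.
by case=> [b|] //=; rewrite /gate_value /= big_mkcond big_bool /= addrC.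
Qed.

Lemma csizeM2 : csize ('X_ord0 * 'X_ord_max : {mpoly F[2]}) 2.
Proof.
exists (binary_circuit (isT : ~~ is_input GProd)); last first.
  by rewrite /circuit_size card_bool.
pose x b : {mpoly F[2]} := 'X_(if b then ord_max else ord0).
exists (fun u => if u is Some b then x b else x false * x true) => //.
by case=> [b|] //=; rewrite /gate_value /= big_mkcond big_bool /= mulrC.
Qed.

Lemma csizeD n (p q : {mpoly F[n]}) s t :
  csize p s -> csize q t -> csize (p + q) (s + t + 2).
Proof.
move=> ps qt; have := @csize_comp 2 n _ [tuple p; q] 2 (tnth [tuple s; t]) csizeD2.
rewrite big_ord_recl big_ord1 comp_mpolyD !comp_mpolyXU /= addnC; apply.
by case=> -[|[]].
Qed.

Lemma csizeM n (p q : {mpoly F[n]}) s t :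
  csize p s -> csize q t -> csize (p * q) (s + t + 2).
Proof.
move=> ps qt; have := @csize_comp 2 n _ [tuple p; q] 2 (tnth [tuple s; t]) csizeM2.
rewrite big_ord_recl big_ord1 rmorphM /= !comp_mpolyXU /= addnC; apply.
by case=> -[|[]].
Qed.

End CircuitSize.

(** * Boolean sums of circuits *)

(** The class of polynomials in the theorem, a quantitative form of VNP: [m] counts the summed bits
    and [s] bounds the circuit size. *)
Definition vsum (F : fieldType) (n m s : nat) (p : {mpoly F[n]}) : Prop :=
  exists2 h : {mpoly F[n + m]}, csize h s &
    p = \sum_(z : {ffun 'I_m -> bool}) subst_bits h z.

(** Treats together the two substitutions needed: renaming bits along [c], for products, and
    replacing the variables x by [q], for affine changes of variables. *)
Lemma subst_bits_comp (F : fieldType) (n k l m : nat) (h : {mpoly F[n + m]})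
    (q : n.-tuple {mpoly F[k]}) (c : 'I_m -> 'I_l) (z : {ffun 'I_l -> bool}) :
  subst_bits (h \mPo [tuple match split i with
                | inl j => tnth q j \mPo [tuple 'X_(lshift l i) | i < k]
                | inr t => 'X_(rshift k (c t))
                end | i < n + m]) z =
  subst_bits h [ffun t => z (c t)] \mPo q.
Proof.
rewrite /subst_bits !comp_mpolyA; congr (_ \mPo _).
apply: eq_from_tnth => i; rewrite !tnth_mktuple; case: (split i) => [j|t].
  rewrite comp_mpolyA comp_mpolyXU -tnth_nth -[RHS]comp_mpoly_id.
  congr (_ \mPo _); apply: eq_from_tnth => u.
  by rewrite !tnth_mktuple comp_mpolyXU -tnth_nth tnth_mktuple
             -[lshift _ _]/(unsplit (inl _)) unsplitK.
rewrite comp_mpolyXU -tnth_nth tnth_mktuple -[rshift _ _]/(unsplit (inr _)) unsplitK.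
by rewrite rmorph_nat ffunE.
Qed.

Section BitSum.

Variables (F : fieldType) (n : nat).
Hypothesis F_char0 : [pchar F] =i pred0.

Lemma vsum_leq m s t (p : {mpoly F[n]}) :
  (s <= t)%N -> vsum m s p -> vsum m t p.
Proof. by move=> le_st [h hs ->]; exists h => //; exact: csize_leq hs. Qed.

(** Both summands read the same bits, so sums do not increase [m]; [vsum_pad] first makes the
    numbers of bits equal. *)
Lemma vsumD m s t (p q : {mpoly F[n]}) :
  vsum m s p -> vsum m t q -> vsum m (s + t + 2) (p + q).
Proof.
move=> [h hs ->] [g gt ->]; exists (h + g); first exact: csizeD.
by rewrite -big_split; apply: eq_bigr => z _; rewrite /subst_bits comp_mpolyD.
Qed.

Lemma big_ffun_ord_split (R : comNzRingType) m l
    (A : {ffun 'I_m -> bool} -> R) (B : {ffun 'I_l -> bool} -> R) :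
  \sum_(z : {ffun 'I_(m + l) -> bool})
     A [ffun t => z (lshift l t)] * B [ffun t => z (rshift m t)] =
  (\sum_z A z) * (\sum_z B z).
Proof.
rewrite big_distrlr pair_big /=; apply/esym.
pose u (z : {ffun 'I_(m + l) -> bool}) :=
  ([ffun t => z (lshift l t)] : {ffun 'I_m -> bool},
   [ffun t => z (rshift m t)] : {ffun 'I_l -> bool}).
rewrite (reindex u) //=.
exists (fun y : {ffun 'I_m -> bool} * {ffun 'I_l -> bool} =>
  [ffun i : 'I_(m + l) => match split i with inl j => y.1 j | inr t => y.2 t end]).
  move=> z _; apply/ffunP => i; rewrite ffunE.
  by case: split_ordP => j -> ; rewrite ffunE.
move=> [y1 y2] _; congr pair; apply/ffunP => t; rewrite !ffunE /=.
  by rewrite -[lshift _ _]/(unsplit (inl _)) unsplitK.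
by rewrite -[rshift _ _]/(unsplit (inr _)) unsplitK.
Qed.

(** The factors receive disjoint blocks of bits, so that the sum over all bits splits as a product
    of two sums. *)
Lemma vsumM m l s t (p q : {mpoly F[n]}) :
  vsum m s p -> vsum l t q -> vsum (m + l) (s + t + 2) (p * q).
Proof.
move=> [h hs ->] [g gt ->].
have ren k (c : 'I_k -> 'I_(m + l)) (w : {mpoly F[n + k]}) r : csize w r ->
    exists2 w' : {mpoly F[n + (m + l)]}, csize w' r &
      forall z, subst_bits w' z = subst_bits w [ffun i => z (c i)].
  move=> wr; eexists; last first.
    move=> z; rewrite -[RHS]comp_mpoly_id; exact: subst_bits_comp.
  apply: (@csize_leq _ _ _ (r + \sum_(i < n + k) 0)); first by rewrite big1 ?addn0.
  apply: csize_comp => // i; rewrite tnth_mktuple.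
  case: (split i) => j; last exact: csizeX.
  by rewrite tnth_mktuple comp_mpolyXU -tnth_nth tnth_mktuple; exact: csizeX.
have [h' h's h'E] := ren m (@lshift m l) h s hs.
have [g' g't g'E] := ren l (@rshift m l) g t gt.
exists (h' * g'); first exact: csizeM.
rewrite -big_ffun_ord_split; apply: eq_bigr => z _.
by rewrite -h'E -g'E /subst_bits rmorphM.
Qed.

(* Spreads a constant evenly over the 2^m assignments. *)
Lemma vsumC m c : vsum m 0 (c%:MP : {mpoly F[n]}).
Proof.
have two_neq0 : (2 ^ m)%:R != 0 :> F.
  by have /pcharf0P -> := F_char0; rewrite expn_eq0.
exists (c / (2 ^ m)%:R)%:MP; first exact: csizeC.
rewrite (eq_bigr (fun=> (c / (2 ^ m)%:R)%:MP)); last first.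
  by move=> z _; rewrite /subst_bits comp_mpolyC.
rewrite sumr_const card_ffun card_bool card_ord -mpolyCMn.
by rewrite -[_ *+ _]mulr_natr divfK.
Qed.

(** Multiply by the constant 1, spread over the [k - m] additional bits. *)
Lemma vsum_pad m k s (p : {mpoly F[n]}) :
  (m <= k)%N -> vsum m s p -> vsum k (s + 2) p.
Proof.
move=> /subnKC <- ps; rewrite -[p]mulr1 -[X in (X + 2)%N]addn0.
by apply: vsumM => //; rewrite -mpolyC1; exact: vsumC.
Qed.

Lemma vsum_sum m s N (G : 'I_N -> {mpoly F[n]}) :
  (forall i, vsum m s (G i)) -> vsum m (N * (s + 2)) (\sum_i G i).
Proof.
elim: N G => [|N IHN] G Gs.
  by rewrite big_ord0 mul0n -mpolyC0; exact: vsumC.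
rewrite big_ord_recr mulSn addnC addnA; apply: vsumD => //.
by apply: IHN => i; exact: Gs.
Qed.

Lemma vsumX m s N (p : {mpoly F[n]}) :
  vsum m s p -> vsum (N * m) (N * (s + 2)) (p ^+ N).
Proof.
move=> ps; elim: N => [|N IHN].
  by rewrite expr0 !mul0n -mpolyC1; exact: vsumC.
rewrite exprS !mulSn [X in vsum _ X]addnAC; exact: vsumM.
Qed.

Lemma vsumZ m s c (p : {mpoly F[n]}) : vsum m s p -> vsum m (s + 2) (c%:MP * p).
Proof.
by move=> ps; apply: (@vsumM 0 m 0 s) => //; exact: vsumC.
Qed.

Lemma vsum_affine m s (p : {mpoly F[n]}) (c : F) (b : 'I_n -> F) :
  vsum m s p ->
  vsum m (s + 4 * n) (p \mPo [tuple c%:MP * 'X_i + (b i)%:MP | i < n]).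
Proof.
move=> [h hs ->]; rewrite rmorph_sum /=; eexists; last first.
  apply: eq_bigr => z _; have -> : z = [ffun t => z (id t)].
    by apply/ffunP => t; rewrite ffunE.
  rewrite -subst_bits_comp; congr (subst_bits _ _).
  by apply/ffunP => t; rewrite ffunE.
(* Each of the [n] variables becomes a product followed by a sum, four wires in all; the bits are
   substituted for free. *)
have -> : (4 * n = \sum_(i < n + m) (if split i is inl _ then 4 else 0))%N.
  rewrite big_split_ord /= (eq_bigr (fun=> 4)); last first.
    by move=> i _; rewrite -[lshift _ _]/(unsplit (inl _)) unsplitK.
  rewrite [X in (_ + X)%N]big1 ?sum_nat_const ?card_ord 1?mulnC ?addn0 //.
  by move=> i _; rewrite -[rshift _ _]/(unsplit (inr _)) unsplitK.
apply: csize_comp => // i; rewrite tnth_mktuple.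
case: (split i) => j; last exact: csizeX.
rewrite tnth_mktuple comp_mpolyD rmorphM /= !comp_mpolyC comp_mpolyXU.
rewrite -tnth_nth tnth_mktuple.
apply: (@csizeD _ _ _ _ 2 0); last exact: csizeC.
by apply: (@csizeM _ _ _ _ 0 0); [exact: csizeC | exact: csizeX].
Qed.

End BitSum.

(** * Truncated logarithm and exponential *)

Section TruncatedSeries.

Variables (S : idomainType) (iv : nat -> S).
Hypothesis ivP : forall j, iv j.+1 * j.+1%:R = 1.
Implicit Types (p q u v L : {poly S}).

Definition Xdvd (k : nat) p : Prop := exists q, p = q * 'X^k.

Lemma XdvdP k p : Xdvd k p <-> (forall i, (i < k)%N -> p`_i = 0).
Proof.
split=> [[q ->] i ik | H]; first by rewrite coefMXn ik.
exists (drop_poly k p); rewrite -[LHS](poly_take_drop k).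
suff -> : take_poly k p = 0 by rewrite add0r.
by apply/polyP => i; rewrite coef_take_poly coef0; case: ifP => // /H.
Qed.

Lemma XdvdD k p q : Xdvd k p -> Xdvd k q -> Xdvd k (p + q).
Proof. by move=> [a ->] [b ->]; exists (a + b); rewrite mulrDl. Qed.

Lemma XdvdN k p : Xdvd k p -> Xdvd k (- p).
Proof. by move=> [a ->]; exists (- a); rewrite mulNr. Qed.

Lemma XdvdB k p q : Xdvd k p -> Xdvd k q -> Xdvd k (p - q).
Proof. by move=> kp /XdvdN; exact: XdvdD. Qed.

Lemma XdvdMl k p q : Xdvd k p -> Xdvd k (q * p).
Proof. by move=> [a ->]; exists (q * a); rewrite mulrA. Qed.

Lemma Xdvd_exp k p : p`_0 = 0 -> Xdvd k (p ^+ k).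
Proof.
move=> p0; have [q ->] : Xdvd 1 p by apply/XdvdP => -[].
by exists (q ^+ k); rewrite exprMn expr1.
Qed.

Lemma Xdvd_leq k l p : (k <= l)%N -> Xdvd l p -> Xdvd k p.
Proof. by move=> kl /XdvdP H; apply/XdvdP => i ik; apply/H/(leq_trans ik). Qed.

Lemma Xdvd_deriv k p : Xdvd k.+1 p -> Xdvd k p^`().
Proof. by move=> /XdvdP H; apply/XdvdP => i ik; rewrite coef_deriv H ?mul0rn. Qed.

Lemma Xdvd_integral k p : p`_0 = 0 -> Xdvd k p^`() -> Xdvd k.+1 p.
Proof.
move=> p0 /XdvdP H; apply/XdvdP => -[//|i]; rewrite ltnS => /H.
rewrite coef_deriv -mulr_natl => /(congr1 ( *%R (iv i.+1))).
by rewrite mulrA ivP mul1r mulr0.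
Qed.

(** The ring S is only a domain, so [u] need not be invertible as a power series; it is cancelled by
    removing lowest coefficients one at a time. *)
Lemma Xdvd_cancel k u p : u`_0 != 0 -> Xdvd k (u * p) -> Xdvd k p.
Proof.
move=> u0; elim: k p => [|k IHk] p kup; first by exists p; rewrite mulr1.
have p0 : p`_0 = 0.
  have /XdvdP/(_ 0%N isT)/eqP := kup.
  by rewrite coef0M mulf_eq0 (negPf u0) => /eqP.
have [q Ep] : Xdvd 1 p by apply/XdvdP => -[].
have [w Ew] := kup; have [|a Ea] := IHk q; last first.
  by rewrite Ep Ea; exists a; rewrite -mulrA -exprD addn1.
exists w; apply: (@mulIf _ 'X); first by rewrite polyX_eq0.
by rewrite -!mulrA -exprSr -Ew Ep.
Qed.

(* The truncation of u0^d log (u / u0), where u0 is the constant term of u and *)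
(* iv j stands for 1 / j; the factor u0^d clears denominators.                  *)
Definition hlog (d : nat) u : {poly S} :=
  \sum_(j < d) ((-1) ^+ j * iv j.+1)%:P * (u - (u`_0)%:P) ^+ j.+1
     * (u`_0 ^+ (d.-1 - j))%:P.

Lemma hlog_coef0 d u : (hlog d u)`_0 = 0.
Proof.
rewrite coef_sum big1 // => j _; rewrite !coef0M exprS coef0M coefB !coefC /=.
by rewrite subrr !(mul0r, mulr0).
Qed.

(** The cleared form of (log u)' = u'/u. With c the constant term and w = u - c, the derivative is
    u' times a geometric sum in -w and c; multiplying by u = c - (-w) telescopes and leaves the
    error -u' (-w)^d. *)
Lemma deriv_hlog d u : Xdvd d (u * (hlog d u)^`() - (u`_0 ^+ d)%:P * u^`()).
Proof.
set c := u`_0; set w := u - c%:P.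
have dw : w^`() = u^`() by rewrite derivB derivC subr0.
have -> : (hlog d u)^`() = u^`() * \sum_(j < d) c%:P ^+ (d.-1 - j) * (- w) ^+ j.
  rewrite raddf_sum big_distrr; apply: eq_bigr => j _ /=.
  rewrite -/c -/w !derivM !derivC mul0r add0r mulr0 addr0 deriv_exp dw /=.
  rewrite -mulr_natl polyCM [(- w) ^+ j]exprNn !polyC_exp polyCN polyC1.
  rewrite -[j.+1%:R]polyC_natr !mulrA.
  have E p : p = (iv j.+1)%:P * (j.+1%:R)%:P * p by rewrite -polyCM ivP mul1r.
  by rewrite [RHS]E; ring.
rewrite mulrCA -[u in u * (\sum_(_ < _) _)](subrK c%:P) -/w.
have -> : w + c%:P = c%:P - (- w) by rewrite opprK addrC.
rewrite -subrXX polyC_exp [X in _ - X]mulrC -mulrBr addrC addKr.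
by apply/XdvdMl/XdvdN/Xdvd_exp; rewrite coefN coefB coefC subrr oppr0.
Qed.

(** Both sides have zero constant term, and by [deriv_hlog] their derivatives agree modulo X^d after
    multiplication by u v; cancel u v and integrate. The extra powers of constant terms bring both
    sides to the denominator (u0 v0)^d. *)
Lemma hlogM d u v : u`_0 != 0 -> v`_0 != 0 ->
  Xdvd d.+1 (hlog d (u * v)
             - ((v`_0 ^+ d)%:P * hlog d u + (u`_0 ^+ d)%:P * hlog d v)).
Proof.
move=> u0 v0; apply: Xdvd_integral.
  by rewrite coefB coefD !coef0M !hlog_coef0 !mulr0 addr0 subrr.
apply: (@Xdvd_cancel _ (u * v)); first by rewrite coef0M mulf_neq0.
have Huv := deriv_hlog d (u * v); have Hu := deriv_hlog d u.
have Hv := deriv_hlog d v.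
have := XdvdB (XdvdB Huv (XdvdMl (v * (v`_0 ^+ d)%:P) Hu))
  (XdvdMl (u * (u`_0 ^+ d)%:P) Hv).
congr (Xdvd _ _).
rewrite coef0M exprMn !derivB !derivD !derivM !derivC !mul0r !add0r !polyCM.
by ring.
Qed.

Lemma hlogX d u e : u`_0 != 0 ->
  Xdvd d.+1 (hlog d (u ^+ e.+1) - (e.+1%:R * u`_0 ^+ (d * e))%:P * hlog d u).
Proof.
move=> u0; elim: e => [|e IHe].
  by exists 0; rewrite muln0 mulr1 mul1r subrr mul0r.
have ue0 : (u ^+ e.+1)`_0 = u`_0 ^+ e.+1 by rewrite -!horner_coef0 horner_exp.
have := @hlogM d u (u ^+ e.+1) u0; rewrite ue0 expf_neq0 // => /(_ isT) H.
have := XdvdD H (XdvdMl (u`_0 ^+ d)%:P IHe); congr (Xdvd _ _).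
rewrite -exprS -exprM.
have -> : (e.+1 * d = d * e.+1)%N by rewrite mulnC.
rewrite [in RHS]mulrSr mulrDl mul1r polyCD [in RHS]mulrDl mulnS exprD.
by rewrite !polyCM; ring.
Qed.

Definition ifact (l : nat) : S := \prod_(i < l) iv i.+1.

Definition hexp (d : nat) L : {poly S} := \sum_(l < d.+1) (ifact l)%:P * L ^+ l.

Lemma deriv_hexp d L :
  (hexp d L)^`() = L^`() * (hexp d L - (ifact d)%:P * L ^+ d).
Proof.
have -> : hexp d L - (ifact d)%:P * L ^+ d = \sum_(l < d) (ifact l)%:P * L ^+ l.
  by rewrite /hexp big_ord_recr /= addrK.
rewrite /hexp raddf_sum big_ord_recl /= expr0 mulr1 derivC add0r big_distrr.
apply: eq_bigr => l _; rewrite /= derivM derivC mul0r add0r deriv_exp /=.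
rewrite /bump leq0n add1n /ifact big_ord_recr /= polyCM -mulr_natl -[l.+1%:R]polyC_natr.
have E p : p = (iv l.+1)%:P * (l.+1%:R)%:P * p by rewrite -polyCM ivP mul1r.
by rewrite [RHS]E; ring.
Qed.

(* Both sides of the congruence solve the linear equation u Y' = u' Y. *)
Lemma hexp_hlog d u L : u`_0 = 1 -> Xdvd d.+1 (L - hlog d u) ->
  Xdvd d.+1 (hexp d L - u).
Proof.
move=> u0 LP; set W := _ - u.
have L0 : L`_0 = 0.
  have /XdvdP/(_ 0%N isT)/eqP := LP.
  by rewrite coefB hlog_coef0 subr0 => /eqP.
have W0 : W`_0 = 0.
  rewrite coefB u0 coef_sum big_ord_recl big1 /= => [|l _].
    by rewrite expr0 mulr1 coefC /ifact big_ord0 addr0 subrr.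
  by rewrite coef0M exprS coef0M L0 mul0r mulr0.
have HW : Xdvd d (u * W^`() - u^`() * W).
  have H1 : Xdvd d (u * L^`() - u^`()).
    have := XdvdD (XdvdMl u (Xdvd_deriv LP)) (deriv_hlog d u).
    congr (Xdvd _ _); rewrite u0 expr1n mul1r derivB; ring.
  have := XdvdB (XdvdMl (hexp d L) H1)
    (XdvdMl (u * L^`() * (ifact d)%:P) (Xdvd_exp d L0)).
  by congr (Xdvd _ _); rewrite /W derivB deriv_hexp; ring.
(* The precision grows by one at each step: if X^k divides W, then u W' is congruent to u' W, hence
   to 0, modulo X^k; cancelling u and integrating gives X^(k+1). *)
suff H k : (k <= d.+1)%N -> Xdvd k W by exact: H.
elim: k => [|k IHk] kd; first by exists W; rewrite mulr1.
apply: Xdvd_integral => //; apply: (@Xdvd_cancel _ u); first by rewrite u0 oner_eq0.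
have := XdvdD (Xdvd_leq _ HW) (XdvdMl u^`() (IHk (ltnW kd))).
by rewrite subrK; apply.
Qed.

End TruncatedSeries.

(** * Irreducible polynomials are prime *)

Definition edvd (R : idomainType) (p a : R) : Prop := exists c, a = p * c.

Definition prime_elt (R : idomainType) (p : R) : Prop :=
  forall a b, edvd p (a * b) -> edvd p a \/ edvd p b.

Section Divisibility.

Variable R : idomainType.
Implicit Types (a b c p : R).

Lemma edvd_mulr p a b : edvd p a -> edvd p (a * b).
Proof. by move=> [c ->]; exists (c * b); rewrite mulrA. Qed.

Lemma edvd_mull p a b : edvd p b -> edvd p (a * b).
Proof. by rewrite mulrC; exact: edvd_mulr. Qed.

Lemma edvdD p a b : edvd p a -> edvd p b -> edvd p (a + b).
Proof. by move=> [c ->] [e ->]; exists (c + e); rewrite mulrDr. Qed.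

Lemma edvdDl p a b : edvd p a -> edvd p (a + b) -> edvd p b.
Proof. by move=> [e Ea] [c E]; exists (c - e); rewrite mulrBr -E -Ea addrC addKr. Qed.

End Divisibility.

Section ConstantDivisors.

Variable R : idomainType.
Implicit Types (a b c p : R).

Lemma edvd_coef p (u : {poly R}) i : edvd p%:P u -> edvd p u`_i.
Proof. by move=> [w ->]; exists w`_i; rewrite coefCM. Qed.

Lemma edvd_polyC p a : edvd p a -> edvd p%:P a%:P.
Proof. by move=> [c ->]; exists c%:P; rewrite polyCM. Qed.

Lemma edvd_MX p (u : {poly R}) : p != 0 -> edvd p%:P (u * 'X) -> edvd p%:P u.
Proof.
move=> p0 [w E]; have [w' Ew] : Xdvd 1 w.
  apply/XdvdP => -[] // _; have /eqP := congr1 (fun q : {poly R} => q`_0) E.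
  by rewrite coefMX coefCM eq_sym mulf_eq0 (negPf p0) => /eqP.
exists w'; apply: (@mulIf _ 'X); first by rewrite polyX_eq0.
by rewrite E Ew mulrA.
Qed.

(** If p divides a b, it divides the product of the constant terms, hence one of them. Subtract that
    term, cancel X and conclude by induction. *)
Lemma prime_polyC p : p != 0 -> prime_elt p -> prime_elt p%:P.
Proof.
move=> p0 pp a; elim/poly_ind: a => [|a c IHa] b.
  by left; exists 0; rewrite mulr0.
elim/poly_ind: b => [|b e IHb] pab; first by right; exists 0; rewrite mulr0.
have [pc|pe] : edvd p c \/ edvd p e.
  apply: pp; have := edvd_coef 0 pab.
  by rewrite coef0M !coefD !coefMX !coefC !add0r.
- have {}pc := edvd_polyC pc.
  have : edvd p%:P (a * (b * 'X + e%:P)).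
    apply: edvd_MX => //; rewrite mulrAC.
    apply: (edvdDl (edvd_mulr (b * 'X + e%:P) pc)).
    by rewrite -mulrDl [c%:P + _]addrC.
  case/IHa => [pa|]; [left | by right].
  by apply: edvdD => //; exact: edvd_mulr.
- have {}pe := edvd_polyC pe.
  have : edvd p%:P ((a * 'X + c%:P) * b).
    apply: edvd_MX => //; rewrite -mulrA.
    apply: (edvdDl (edvd_mull (a * 'X + c%:P) pe)).
    by rewrite -mulrDr [e%:P + _]addrC.
  case/IHb => [|pb]; [by left | right].
  by apply: edvdD => //; exact: edvd_mulr.
Qed.

Lemma not_irreducible c : c != 0 -> c \isn't a GRing.unit ->
  ~ irreducible_elt c ->
  exists a b, [/\ c = a * b, a \isn't a GRing.unit & b \isn't a GRing.unit].
Proof.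
move=> c0 cu ci; apply: NNPP => H; apply: ci; split=> // a b E.
have [au|au] := boolP (a \is a GRing.unit); first by left.
by right; apply: contraPT isT => bu; case: H; exists a, b.
Qed.

End ConstantDivisors.

Lemma prime_elt_iso (R S : idomainType) (phi : {rmorphism R -> S}) (psi : S -> R)
    (p : R) :
  cancel phi psi -> cancel psi phi -> prime_elt p <-> prime_elt (phi p).
Proof.
move=> phiK psiK; split=> [pp a b [c E]|pp a b [c E]].
  case: (pp (psi a) (psi b)) => [|[e Ea]|[e Eb]].
  - by exists (psi c); apply: (can_inj phiK); rewrite !rmorphM !psiK.
  - by left; exists (phi e); rewrite -rmorphM -Ea psiK.
  - by right; exists (phi e); rewrite -rmorphM -Eb psiK.
case: (pp (phi a) (phi b)) => [|[e Ea]|[e Eb]].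
- by exists (phi c); rewrite -!rmorphM E.
- by left; exists (psi e); apply: (can_inj phiK); rewrite rmorphM psiK.
- by right; exists (psi e); apply: (can_inj phiK); rewrite rmorphM psiK.
Qed.

Lemma irreducible_iso (R S : idomainType) (phi : {rmorphism R -> S}) (psi : S -> R)
    (p : R) :
  cancel phi psi -> cancel psi phi -> irreducible_elt p -> irreducible_elt (phi p).
Proof.
move=> phiK psiK [p0 pu pi].
have phi_inj := can_inj phiK.
have unitP x : phi x \is a GRing.unit -> x \is a GRing.unit.
  move=> xu; apply/unitrP; exists (psi (phi x)^-1).
  by split; apply: phi_inj; rewrite rmorphM psiK rmorph1 ?mulVr ?mulrV.
split=> [||a b E].
- by rewrite -(rmorph0 phi) inj_eq.
- by apply: contra pu; exact: unitP.
- case: (pi (psi a) (psi b)) => [|au|bu].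
  + by apply: phi_inj; rewrite rmorphM !psiK.
  + by left; rewrite -[a]psiK rmorph_unit.
  + by right; rewrite -[b]psiK rmorph_unit.
Qed.

Section Gauss.

Variables (R : idomainType) (mu : R -> nat).
Hypothesis mu_mul : forall a b : R,
  a != 0 -> b != 0 -> b \isn't a GRing.unit -> (mu a < mu (a * b))%N.
Hypothesis irr_prime : forall p : R, irreducible_elt p -> prime_elt p.
Implicit Types (u w X f g : {poly R}).

(** The form of Gauss's lemma used here: a constant dividing u w can be distributed over the two
    factors. A unit goes into one factor, an irreducible c is prime in R[X] and divides one of them,
    and a reducible c is split and treated by induction on [mu]. *)
Lemma polyC_cancel_factor (c : R) X u w :
  c != 0 -> c%:P * X = u * w ->
  exists a b u' w', [/\ X = u' * w', u = a%:P * u', w = b%:P * w' & a * b != 0].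
Proof.
have [k] := ubnP (mu c); elim: k c X u w => // k IHk c X u w ck c0 E.
have [cu|cu] := boolP (c \is a GRing.unit).
  have VK : (c^-1)%:P * c%:P = 1 by rewrite -polyCM mulVr.
  exists c, 1, ((c^-1)%:P * u), w; split; rewrite ?mulr1 ?mul1r //.
    by rewrite -mulrA -E mulrA VK mul1r.
  by rewrite mulrA [c%:P * _]mulrC VK mul1r.
have cP0 : c%:P != 0 by rewrite polyC_eq0.
have [ci|/not_irreducible[]// a [b [Ec au bu]]] := classic (irreducible_elt c).
  case: (@prime_polyC _ c c0 (irr_prime ci) u w) => [|[u' Eu]|[w' Ew]].
  - by exists X.
  - exists c, 1, u', w; rewrite mulr1 mul1r; split=> //.
    by apply: (mulfI cP0); rewrite E Eu mulrA.
  - exists 1, c, u, w'; rewrite !mul1r; split=> //.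
    by apply: (mulfI cP0); rewrite E Ew mulrCA.
have [a0 b0] : a != 0 /\ b != 0.
  by apply/andP; rewrite -negb_or -mulf_eq0 -Ec.
have [||a1 [b1 [u1 [w1 [E1 Eu1 Ew1 n1]]]]] := IHk a (b%:P * X) u w _ a0.
- by rewrite -ltnS (leq_trans _ ck) // ltnS Ec mu_mul.
- by rewrite mulrA -polyCM -Ec.
have [|a2 [b2 [u2 [w2 [E2 Eu2 Ew2 n2]]]]] := IHk b X u1 w1 _ b0 E1.
  by rewrite -ltnS (leq_trans _ ck) // ltnS Ec mulrC mu_mul.
exists (a1 * a2), (b1 * b2), u2, w2; split=> //.
- by rewrite Eu1 Eu2 polyCM mulrA.
- by rewrite Ew1 Ew2 polyCM mulrA.
- by rewrite mulrACA mulf_neq0.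
Qed.

Lemma size_polyC_neq0_mul (a : R) u : a != 0 -> size (a%:P * u) = size u.
Proof. by move=> a0; rewrite mul_polyC size_scale. Qed.

(** Distributing c over c g = f w extracts a constant from f; by irreducibility that constant is a
    unit, so what is left of f still divides g. *)
Lemma edvd_polyC_cancel (c : R) f g : irreducible_elt f -> (1 < size f)%N ->
  c != 0 -> edvd f (c%:P * g) -> edvd f g.
Proof.
move=> [f0 fu fi] sf c0 [w /(polyC_cancel_factor c0)].
move=> [a [b [f' [w' [-> Ef Ew]]]]]; rewrite mulf_eq0 => /norP[a0 b0].
apply: edvd_mulr; case: (fi _ _ Ef) => [au|f'u]; last first.
  by move: f'u sf; rewrite Ef size_polyC_neq0_mul // poly_unitE => /andP[/eqP->].
by exists (a%:P^-1); rewrite Ef mulrAC mulrV ?mul1r.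
Qed.

(** Suppose f has positive degree, divides a b and does not divide a. A nonzero resultant r of f and
    a lies in their ideal, so f divides r b, hence b. A zero resultant gives a common divisor of
    positive degree up to constants; irreducibility makes it f up to constants, so f divides a after
    all. *)
Lemma irr_prime_poly f : irreducible_elt f -> prime_elt f.
Proof.
move=> fi; have [f0 fu fP] := fi.
have [sf|sf] := leqP (size f) 1.
  have [c Ef] : exists c, f = c%:P by exists f`_0; exact: size1_polyC.
  have c0 : c != 0 by rewrite -polyC_eq0 -Ef.
  have cu x : (x%:P : {poly R}) \is a GRing.unit -> x \is a GRing.unit.
    by rewrite poly_unitE coefC /= => /andP[].
  rewrite Ef; apply: prime_polyC => //; apply: irr_prime; split=> //.
    apply: contra fu => cu'; rewrite Ef; exact: rmorph_unit.
  move=> a b Ec; have [] := fP a%:P b%:P; first by rewrite Ef Ec polyCM.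
    by move/cu; left.
  by move/cu; right.
move=> a b fab; have [|fa] := classic (edvd f a); first by left.
right; have [sa|sa] := leqP (size a) 1.
  have Ea := size1_polyC sa.
  apply: (edvd_polyC_cancel (c := a`_0)) => //; last by rewrite -Ea.
  by apply: contra_notN fa => /eqP E0; exists 0; rewrite mulr0 Ea E0.
have [[u v] _ Er] := resultant_in_ideal sf sa.
have [r0|r0] := eqVneq (resultant f a) 0; last first.
  apply: (edvd_polyC_cancel (c := resultant f a)) => //.
  rewrite Er /= mulrDl -mulrA mulrCA; apply: edvdD; first by exists (u * b).
  by rewrite -mulrA; exact: edvd_mull.
case: fa; have := resultant_eq0 f a; rewrite r0 eqxx => /esym.
set D := gcdp f a => sD.
have /Pdiv.Idomain.dvdpP[[c q] /= c0 Ef] : D %| f by exact: Pdiv.Idomain.dvdp_gcdl.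
have /Pdiv.Idomain.dvdpP[[c' q'] /= c'0 Ea] : D %| a by exact: Pdiv.Idomain.dvdp_gcdr.
move: Ef; rewrite -mul_polyC => /(polyC_cancel_factor c0).
move=> [x [y [q1 [D1 [Ef Eq ED]]]]]; rewrite mulf_eq0 => /norP[x0 y0].
apply: (edvd_polyC_cancel (c := c')) => //; rewrite mul_polyC Ea.
apply: edvd_mull; rewrite ED; apply: edvd_mull.
case: (fP _ _ Ef) => [q1u|D1u]; last first.
  move: D1u sD; rewrite ED size_polyC_neq0_mul // poly_unitE.
  by move=> /andP[/eqP->].
by exists (q1^-1); rewrite Ef mulrAC mulrV ?mul1r.
Qed.

End Gauss.

Lemma mpoly_unit_msize (F : fieldType) (n : nat) (p : {mpoly F[n]}) :
  p != 0 -> (p \is a GRing.unit) = (msize p <= 1)%N.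
Proof.
move=> p0; apply/idP/idP => [/andP[/eqP-> _]|sp].
  by rewrite msizeC; case: eqP.
apply/andP; split; first exact/eqP/msize1_polyC.
rewrite unitfE; apply: contraNneq p0 => E.
by rewrite (msize1_polyC sp) E mpolyC0.
Qed.

Lemma muni_iso (n : nat) (R : comNzRingType) :
  exists2 psi : {poly {mpoly R[n]}} -> {mpoly R[n.+1]},
    cancel (@muni n R) psi & cancel psi (@muni n R).
Proof.
pose psi := horner_eval ('X_ord_max : {mpoly R[n.+1]}) \o map_poly (@mwiden n R).
have mwX (j : 'I_n) : mwiden ('X_j : {mpoly R[n]}) = 'X_(widen_ord (leqnSn n) j).
  by rewrite mwidenX mnmwiden1.
have muniX i : muni ('X_i : {mpoly R[n.+1]}) =
    match split (cast_ord (esym (addn1 n)) i) with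
    | inl j => ('X_j)%:P
    | inr _ => 'X
    end by rewrite /muni mmapX mmap1U.
have muni_widen (j : 'I_n) :
    muni ('X_(widen_ord (leqnSn n) j) : {mpoly R[n.+1]}) = ('X_j)%:P.
  rewrite muniX; case: splitP => [k /= Ek|k /= Ek].
    by congr ('X__)%:P; exact/val_inj.
  by have := ltn_ord j; rewrite Ek ltnNge leq_addr.
have muni_max : muni ('X_ord_max : {mpoly R[n.+1]}) = 'X.
  rewrite muniX; case: splitP => // k /= Ek.
  by have := ltn_ord k; rewrite -Ek ltnn.
exists psi.
  apply: (@mpoly_rmorph_eq _ _ _ (psi \o @muni n R) idfun) => [c|i] /=.
    by rewrite muniC map_polyC /= /horner_eval hornerC mwidenC.
  case: (unliftP ord_max i) => [j ->|->]; last first.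
    by rewrite muni_max map_polyX /horner_eval hornerX.
  have -> : lift ord_max j = widen_ord (leqnSn n) j.
    by apply: val_inj; exact: lift_max.
  by rewrite muni_widen map_polyC /= /horner_eval hornerC mwX.
have muni_mwiden : @muni n R \o @mwiden n R =1 polyC.
  apply: (@mpoly_rmorph_eq _ _ _ (@muni n R \o @mwiden n R) polyC) => [c|i] /=.
    by rewrite mwidenC muniC.
  by rewrite mwX muni_widen.
move=> q; rewrite /psi /= /horner_eval horner_coef rmorph_sum -[RHS]coefK poly_def.
rewrite size_map_inj_poly ?mwiden0 //; last exact: inj_mwiden.
apply: eq_bigr => i _; rewrite coef_map rmorphM rmorphXn /= muni_max.
by rewrite -mul_polyC -muni_mwiden.
Qed.

(** Induction on the number of variables, [msize] being the measure in Gauss's lemma. Without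
    variables every nonzero polynomial is a unit, so nothing is irreducible. *)
Lemma mpoly_irr_prime (F : fieldType) (n : nat) (p : {mpoly F[n]}) :
  irreducible_elt p -> prime_elt p.
Proof.
elim: n p => [|n IHn] p pi.
  have [p0 /negP[]] := pi; rewrite mpoly_unit_msize //.
  rewrite msizeE; apply/bigmax_leqP_seq => m _ _.
  by rewrite mdegE big_ord0.
have [psi muniK psiK] := muni_iso n F.
apply/(prime_elt_iso p muniK psiK).
apply: (@irr_prime_poly _ (fun q => msize q) _ IHn); last first.
  exact: irreducible_iso psiK pi.
move=> a b a0 b0; rewrite mpoly_unit_msize // -ltnNge msizeM // => sb.
by rewrite -subn1 -addnBA ?(ltnW sb) // -[X in (X < _)%N]addn0 ltn_add2l subn_gt0.
Qed.

(** * Restriction to generic lines *)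

Section NonVanishing.

Variable F : fieldType.
Hypothesis F_char0 : [pchar F] =i pred0.

Lemma natr_inj_char0 : injective (fun k : nat => k%:R : F).
Proof.
move=> k l; wlog le_kl : k l / (k <= l)%N => [H|].
  by case/orP: (leq_total k l) => /H // {}H /esym/H.
move=> /esym/eqP; rewrite -(subnK le_kl) natrD addrC -subr_eq0 addrAC subrr add0r.
have /pcharf0P -> := F_char0; rewrite subn_eq0 => lk; rewrite subnK //.
exact/anti_leq/andP.
Qed.

Lemma poly_nonroot (q : {poly F}) : q != 0 -> exists x, q.[x] != 0.
Proof.
move=> q0; pose s := [seq k%:R : F | k <- iota 0 (size q)].
have [sr|/allPn[x _ xr]] := boolP (all (root q) s); last by exists x.
have := max_poly_roots q0 sr; rewrite size_map size_iota ltnn.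
by rewrite map_inj_uniq ?iota_uniq; [move/(_ isT) | exact: natr_inj_char0].
Qed.

Lemma mpoly_nonroot n (p : {mpoly F[n]}) : p != 0 -> exists a, p.@[a] != 0.
Proof.
elim: n p => [|n IHn] p p0.
  exists (fun=> 0); apply: contraNneq p0 => p00; apply/eqP/mpolyP => m.
  have Ep : p = (p@_0)%:MP.
    apply: msize1_polyC; rewrite msizeE; apply/bigmax_leqP_seq => m' _ _.
    by rewrite mdegE big_ord0.
  by move: p00; rewrite Ep mevalC => ->; rewrite mpolyC0.
have [psi muniK _] := muni_iso n F.
have q0 : muni p != 0.
  by apply: contraNneq p0 => E; rewrite -(muniK p) E -(muni0 n F) muniK.
have [a' a'P] : exists a', (lead_coef (muni p)).@[a'] != 0.
  by apply: IHn; rewrite lead_coef_eq0.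
have [|y yP] := @poly_nonroot (map_poly (meval a') (muni p)).
  by rewrite -size_poly_eq0 size_map_poly_id0 // size_poly_eq0.
pose a i := match split (cast_ord (esym (addn1 n)) i) with
  inl j => a' j | inr _ => y end.
exists a; suff -> : p.@[a] = (map_poly (meval a') (muni p)).[y] by [].
apply: (@mpoly_rmorph_eq _ _ _ (meval a)
  (horner_eval y \o (map_poly (meval a') \o @muni n F))) => [c|i] /=.
  by rewrite mevalC muniC map_polyC /= /horner_eval hornerC mevalC.
rewrite mevalXU /muni mmapX mmap1U /a /horner_eval.
case: (split _) => [j|_]; first by rewrite map_polyC /= hornerC mevalXU.
by rewrite map_polyX hornerX.
Qed.

Lemma mpoly_eq_meval n (p q : {mpoly F[n]}) :
  (forall a, p.@[a] = q.@[a]) -> p = q.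
Proof.
move=> H; apply/eqP; rewrite -subr_eq0; apply: contraT => /mpoly_nonroot[a].
by rewrite mevalB H subrr eqxx.
Qed.

End NonVanishing.

Section Lines.

Variables (F : fieldType) (n : nat).
Implicit Types (a v : 'I_n -> F) (p : {mpoly F[n]}).

Definition line a v p : {poly F} :=
  mmap polyC (fun i => (a i)%:P + (v i)%:P * 'X) p.

HB.instance Definition _ a v := GRing.RMorphism.copy (line a v)
  (mmap polyC (fun i => (a i)%:P + (v i)%:P * 'X)).

Lemma lineC a v c : line a v c%:MP = c%:P.
Proof. by rewrite /line mmapC. Qed.

Lemma lineX a v i : line a v 'X_i = (a i)%:P + (v i)%:P * 'X.
Proof. by rewrite /line mmapX mmap1U. Qed.

Definition leading_form (d : nat) p : {mpoly F[n]} :=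
  \sum_(m <- msupp p) if mdeg m == d then p@_m *: 'X_[m] else 0.

Lemma leading_form_neq0 d p : msize p = d.+1 -> leading_form d p != 0.
Proof.
move=> sp; have p0 : p != 0 by rewrite -msize_poly_eq0 sp.
have ml : mdeg (mlead p) == d by rewrite -eqSS mlead_deg // sp.
suff E : (leading_form d p)@_(mlead p) = mleadc p.
  by apply: contra_eqN E => /eqP->; rewrite mcoeff0 eq_sym mleadc_eq0.
rewrite /leading_form raddf_sum /= (bigD1_seq (mlead p)) ?mlead_supp ?msupp_uniq //=.
rewrite ml mcoeffZ mcoeffX eqxx mulr1 big1 ?addr0 // => m mp.
by case: ifP => _; rewrite ?mcoeff0 // mcoeffZ mcoeffX (negPf mp) mulr0.
Qed.

Let top k (c : F) (q : {poly F}) : Prop := (size q <= k.+1)%N /\ q`_k = c.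

Let topM k l (c e : F) (p q : {poly F}) :
  top k c p -> top l e q -> top (k + l) (c * e) (p * q).
Proof.
move=> [sp pk] [sq ql]; split.
  apply: leq_trans (size_polyMleq _ _) _.
  by rewrite -subn1 leq_subLR add1n -addnS -addSn leq_add.
have lt_k : (k < (k + l).+1)%N by rewrite ltnS leq_addr.
rewrite coefM (bigD1 (Ordinal lt_k)) //= addKn pk ql big1 ?addr0 // => i.
rewrite -val_eqE /=; case: ltngtP => // ik _.
  rewrite [q`__]nth_default ?mulr0 // (leq_trans sq) // ltn_subRL.
  by rewrite ltn_add2r.
by rewrite [p`__]nth_default ?mul0r // (leq_trans sp).
Qed.

Let top_mmap1 a v (m : 'X_{1..n}) : top (mdeg m) (\prod_i v i ^+ m i)
  (mmap1 (fun i => (a i)%:P + (v i)%:P * 'X) m).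
Proof.
rewrite /mmap1 mdegE; elim/big_rec3: _ => [|i q k w _ IH].
  by split; rewrite ?coefC // size_poly1.
apply: topM => //; elim: (m i) => [|j IHj].
  by split; rewrite ?coefC // size_poly1.
rewrite !exprS -add1n; apply: topM => //; split.
  rewrite (leq_trans (size_polyD _ _)) // geq_max.
  rewrite (leq_trans (size_polyC_leq1 _)) //= mul_polyC.
  by rewrite (leq_trans (size_scale_leq _ _)) // size_polyX.
by rewrite coefD coefC add0r coefCM coefX mulr1.
Qed.

Lemma line_coef_leading a v d p :
  msize p = d.+1 -> (line a v p)`_d = (leading_form d p).@[v].
Proof.
move=> sp; rewrite /line /mmap coef_sum raddf_sum !big_seq.
apply: eq_bigr => m mp; rewrite coefCM.
have [sm tm] := top_mmap1 a v m.
case: ifP => [/eqP<-|md] /=; first by rewrite tm mevalZ mevalX.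
rewrite meval0 nth_default ?mulr0 // (leq_trans sm) //.
by rewrite ltn_neqAle md -ltnS -sp msize_mdeg_lt.
Qed.

Lemma size_line_leq a v p : (size (line a v p) <= msize p)%N.
Proof.
rewrite /line /mmap big_seq; elim/big_ind: _ => [|q w sq sw|m mp].
- by rewrite size_poly0.
- by rewrite (leq_trans (size_polyD _ _)) // geq_max sq.
have [sm _] := top_mmap1 a v m.
rewrite mul_polyC (leq_trans (size_scale_leq _ _)) // (leq_trans sm) //.
exact: msize_mdeg_lt.
Qed.

Lemma size_line a v d p :
  msize p = d.+1 -> (leading_form d p).@[v] != 0 -> size (line a v p) = d.+1.
Proof.
move=> sp pv; apply/anti_leq; rewrite -{1}sp size_line_leq /= ltnNge.
by apply: contra pv => sl; rewrite -(line_coef_leading a v sp) nth_default.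
Qed.

End Lines.

Section Shear.

Variables (F : fieldType) (n : nat).
Implicit Types (a v : 'I_n -> F) (p : {mpoly F[n]}).

Local Notation A := {mpoly F[n]}.

(** The restriction to the line of direction [v] through a generic point, whose coordinates are kept
    as variables. *)
Definition shear v p : {poly A} :=
  mmap (polyC \o @mpolyC n F) (fun i => ('X_i)%:P + ((v i)%:MP)%:P * 'X) p.

HB.instance Definition _ v := GRing.RMorphism.copy (shear v)
  (mmap (polyC \o @mpolyC n F) (fun i => ('X_i)%:P + ((v i)%:MP)%:P * 'X)).

Lemma shearC v c : shear v c%:MP = (c%:MP)%:P.
Proof. by rewrite /shear mmapC. Qed.

Lemma shearX v i : shear v 'X_i = ('X_i)%:P + ((v i)%:MP)%:P * 'X.
Proof. by rewrite /shear mmapX mmap1U. Qed.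

Lemma map_shear a v p : map_poly (meval a) (shear v p) = line a v p.
Proof.
apply: (@mpoly_rmorph_eq _ _ _ (map_poly (meval a) \o shear v) (line a v)) => [c|i] /=.
  by rewrite shearC map_polyC /= mevalC lineC.
by rewrite shearX rmorphD rmorphM /= !map_polyC map_polyX /= mevalC mevalXU lineX.
Qed.

(** Extends [shear v] to an automorphism of A[y] fixing y, with inverse the shear by -v; primality
    of f is thereby carried over to [shear v f]. *)
Definition shear_poly v : {poly A} -> {poly A} :=
  horner_eval 'X \o map_poly (shear v).

HB.instance Definition _ v := GRing.RMorphism.copy (shear_poly v)
  (horner_eval ('X : {poly A}) \o map_poly (shear v)).

Lemma shear_polyC v p : shear_poly v p%:P = shear v p.
Proof. by rewrite /shear_poly /= map_polyC /= /horner_eval hornerC. Qed.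

Lemma shear_polyX v : shear_poly v 'X = 'X.
Proof. by rewrite /shear_poly /= map_polyX /= /horner_eval hornerX. Qed.

Lemma shear_polyK v w : (forall i, v i + w i = 0) ->
  cancel (shear_poly v) (shear_poly w).
Proof.
move=> vw; have E p : shear_poly w (shear v p) = p%:P.
  apply: (@mpoly_rmorph_eq _ _ _ (shear_poly w \o shear v) polyC) => [c|i] /=.
    by rewrite shearC shear_polyC shearC.
  rewrite shearX rmorphD rmorphM /= !shear_polyC shear_polyX shearX shearC.
  by rewrite -addrA -mulrDl -polyCD -mpolyCD [w i + _]addrC vw mpolyC0 mul0r addr0.
elim/poly_ind => [|q c IHq]; first by rewrite !rmorph0.
rewrite rmorphD rmorphM /= shear_polyX shear_polyC.
by rewrite rmorphD rmorphM /= shear_polyX IHq E.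
Qed.

End Shear.

(** The resultant serves as r. If it were zero, f and g would have a common divisor D of positive
    degree up to constants, say c f = q D; as q has smaller degree than f, primality would make f
    divide D and then g. *)
Lemma prime_bezout (R : idomainType) (f g : {poly R}) :
  prime_elt f -> (1 < size f)%N -> ~ edvd f g ->
  exists u v r, r != 0 /\ u * f + v * g = r%:P.
Proof.
move=> fp sf fg; have f0 : f != 0 by rewrite -size_poly_gt0 ltnW.
have [sg|sg] := leqP (size g) 1.
  exists 0, 1, g`_0; rewrite mul0r add0r mul1r -(size1_polyC sg); split=> //.
  by apply: contra_notN fg => /eqP E; exists 0; rewrite mulr0 (size1_polyC sg) E.
have [[u v] _ Er] := resultant_in_ideal sf sg.
have [r0|r0] := eqVneq (resultant f g) 0; last by exists u, v, (resultant f g).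
have := resultant_eq0 f g; rewrite r0 eqxx => /esym; set D := gcdp f g => sD.
have /Pdiv.Idomain.dvdpP[[c q] /= c0 Ef] : D %| f by exact: Pdiv.Idomain.dvdp_gcdl.
have /Pdiv.Idomain.dvdpP[[c' q'] /= c'0 Eg] : D %| g by exact: Pdiv.Idomain.dvdp_gcdr.
have no_dvd (w : {poly R}) : w != 0 -> (size w < size f)%N -> ~ edvd f w.
  move=> w0 sw [x Ew]; move: sw; rewrite ltnNge Ew size_mul //; last first.
    by apply: contraNneq w0 => x0; rewrite Ew x0 mulr0.
  have : x != 0 by apply: contraNneq w0 => x0; rewrite Ew x0 mulr0.
  by rewrite -size_poly_gt0; case: (size x) => // k _; rewrite addnS leq_addr.
have q0 : q != 0.
  by apply: contra_eq_neq Ef => ->; rewrite mul0r -mul_polyC mulf_neq0 // polyC_eq0.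
have [] := fp q D; first by exists c%:P; rewrite -Ef -mul_polyC mulrC.
  move/no_dvd => /(_ q0) [].
  rewrite -(size_scale f c0) Ef size_mul //; last by rewrite -size_poly_gt0 ltnW.
  by case: (size D) sD => // -[] // k _; rewrite !addnS ltnS leq_addr.
move=> fD; have : edvd f (c'%:P * g) by rewrite mul_polyC Eg; exact: edvd_mull.
case/fp => // /no_dvd []; first by rewrite polyC_eq0.
by rewrite size_polyC c'0.
Qed.

(** The direction v avoids the zeros of the leading form of f, so the degree is kept. The sheared f
    and g satisfy a Bezout relation with right-hand side r depending only on the base point; any a
    with f(a) r(a) nonzero works. *)
Lemma generic_line (F : fieldType) n (f g : {mpoly F[n]}) d :
  [pchar F] =i pred0 -> irreducible_elt f -> msize f = d.+1 -> ~ edvd f g ->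
  exists a v, [/\ f.@[a] != 0, size (line a v f) = d.+1 &
    coprimep (line a v f) (line a v g)].
Proof.
move=> F0 fi sf fg; have [f0 fu _] := fi.
have [v vP] := mpoly_nonroot F0 (leading_form_neq0 sf).
have vK : cancel (shear_poly v) (shear_poly (fun i => - v i)).
  by apply: shear_polyK => i; rewrite subrr.
have Kv : cancel (shear_poly (fun i => - v i)) (shear_poly v).
  by apply: shear_polyK => i; rewrite addNr.
have [|||u [w [r [r0 E]]]] := @prime_bezout _ (shear v f) (shear v g).
- rewrite -shear_polyC; apply: (iffLR (prime_elt_iso _ vK Kv)).
  by apply: prime_polyC => //; exact: mpoly_irr_prime.
- apply: (@leq_trans d.+1).
    rewrite ltnS lt0n; apply: contra fu => /eqP d0.
    by rewrite mpoly_unit_msize ?sf ?d0.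
  rewrite -(size_line (fun=> 0) sf vP) -map_shear; exact: size_poly.
- move=> [c E]; apply: fg; set w := shear_poly (fun i => - v i) in vK Kv *.
  have Eg : g%:P = f%:P * w c.
    apply: (can_inj vK).
    transitivity (shear_poly v f%:P * shear_poly v (w c)); last exact/esym/rmorphM.
    by rewrite Kv !shear_polyC.
  by exists (w c)`_0; rewrite -coefCM -Eg coefC.
have [|a] := mpoly_nonroot F0 (p := f * r); first by rewrite mulf_neq0.
rewrite mevalM mulf_eq0 => /norP[fa ra].
exists a, v; split=> //; first exact: size_line.
apply/Bezout_eq1_coprimepP.
pose ev : {poly {mpoly F[n]}} -> {poly F} := map_poly (meval a).
have evM x y : ev (x * y) = ev x * ev y by exact: rmorphM.
have evD x y : ev (x + y) = ev x + ev y by exact: rmorphD.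
have {}E : ev u * line a v f + ev w * line a v g = (r.@[a])%:P.
  rewrite -[line a v f]map_shear -[line a v g]map_shear.
  rewrite -[LHS]/(ev _ * ev _ + ev _ * ev _).
  by rewrite -2!evM -evD E; exact: map_polyC.
exists ((r.@[a]^-1)%:P * ev u, (r.@[a]^-1)%:P * ev w).
by rewrite /= -!mulrA -mulrDr E -polyCM mulVf.
Qed.

(** * Recovering a factor from the logarithm of the product *)

Lemma hlog_map (S S' : idomainType) (phi : {rmorphism S -> S'}) iv iv' d u :
  (forall j, iv' j = phi (iv j)) ->
  hlog iv' d (map_poly phi u) = map_poly phi (hlog iv d u).
Proof.
move=> ivE; rewrite /hlog rmorph_sum; apply: eq_bigr => j _.
rewrite !rmorphM rmorphXn rmorphB /= !map_polyC /= coef_map.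
by rewrite ivE !(rmorphXn phi) rmorphN1.
Qed.

Lemma subn_predKC j d : (j < d)%N -> (j.+1 + (d.-1 - j) = d)%N.
Proof. by case: d => // k jk; rewrite addSn subnKC. Qed.

Lemma hlog_scale (S : idomainType) (iv : nat -> S) d c u :
  hlog iv d (c *: u) = c ^+ d *: hlog iv d u.
Proof.
rewrite /hlog scaler_sumr; apply: eq_bigr => j _.
rewrite coefZ [(c * u`_0)%:P]polyCM -[c *: u]mul_polyC -mulrBr !exprMn -mul_polyC.
have -> : c ^+ d = c ^+ j.+1 * c ^+ (d.-1 - j).
  by rewrite -exprD subn_predKC.
by rewrite !polyCM !polyC_exp; ring.
Qed.

Section Functionals.

Variable F : fieldType.
Variable lam : {poly F} -> F.
Hypothesis lam_lin : scalar lam.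

Lemma functional0 : lam 0 = 0.
Proof. by have := lam_lin (-1) 0 0; rewrite scaler0 addr0 mulN1r addNr. Qed.

Lemma functionalD p q : lam (p + q) = lam p + lam q.
Proof. by have := lam_lin 1 p q; rewrite scale1r mul1r. Qed.

Lemma functionalZ c p : lam (c *: p) = c * lam p.
Proof. by have := lam_lin c p 0; rewrite functional0 !addr0. Qed.

Lemma functional_sum (I : Type) (r : seq I) (p : I -> {poly F}) :
  lam (\sum_(i <- r) p i) = \sum_(i <- r) lam (p i).
Proof. exact: (big_morph lam functionalD functional0). Qed.

(** Lagrange interpolation at the integers 0, ..., K; [nu k] is the value of [lam] at the k-th
    Lagrange polynomial. *)
Lemma interpolation K : [pchar F] =i pred0 ->
  exists nu : nat -> F, forall q : {poly F}, (size q <= K.+1)%N ->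
    lam q = \sum_(k < K.+1) nu k * q.[k%:R].
Proof.
move=> F0; have x_inj := natr_inj_char0 F0.
pose x k := k%:R : F.
exists (fun k => lam (tnth (@lagrange _ K.+1 x) (inord k))) => q sq.
rewrite {1}(@lagrange_gen _ K.+1 x (ltn0Sn _) x_inj q sq) functional_sum.
by apply: eq_bigr => k _; rewrite mul_polyC functionalZ inord_val mulrC.
Qed.

End Functionals.

Section Bidegree.

Variable F : fieldType.
Implicit Types p q : {poly {poly F}}.

Definition ydeg N p : Prop := forall i, (size (p`_i)%R <= N.+1)%N.

Lemma ydegM M N p q : ydeg M p -> ydeg N q -> ydeg (M + N) (p * q).
Proof.
move=> pM qN i; rewrite coefM; elim/big_ind: _ => [|u v su sv|j _].
- by rewrite size_poly0.
- by rewrite (leq_trans (size_polyD _ _)) // geq_max su.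
rewrite (leq_trans (size_polyMleq _ _)) // -subn1 leq_subLR add1n.
by rewrite -addnS -addSn leq_add.
Qed.

Lemma ydegC N (c : {poly F}) : (size c <= N.+1)%N -> ydeg N c%:P.
Proof. by move=> sc [|i]; rewrite coefC //= size_poly0. Qed.

Lemma ydegX N p k : ydeg N p -> ydeg (N * k) (p ^+ k).
Proof.
move=> pN; elim: k => [|k IHk]; last by rewrite exprS mulnS; exact: ydegM.
by rewrite muln0; apply: ydegC; rewrite size_poly1.
Qed.

(** A bound on the total degree in the outer and inner variables together. *)
Definition tdeg N p : Prop := forall i j, (N < i + j)%N -> p`_i`_j = 0.

Lemma tdeg_leq M N p : (M <= N)%N -> tdeg M p -> tdeg N p.
Proof. by move=> MN pM i j ij; apply: pM; exact: leq_ltn_trans ij. Qed.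

Lemma tdeg0 N : tdeg N 0.
Proof. by move=> i j _; rewrite !coef0. Qed.

Lemma tdegD N p q : tdeg N p -> tdeg N q -> tdeg N (p + q).
Proof. by move=> pN qN i j ij; rewrite !coefD pN // qN // addr0. Qed.

Lemma tdegN N p : tdeg N p -> tdeg N (- p).
Proof. by move=> pN i j ij; rewrite !coefN pN // oppr0. Qed.

Lemma tdegM M N p q : tdeg M p -> tdeg N q -> tdeg (M + N) (p * q).
Proof.
move=> pM qN i j ij; rewrite coefM coef_sum big1 // => -[k /= ki] _.
rewrite coefM big1 // => -[l /= lj] _.
have [kl|kl] := ltnP M (k + l); first by rewrite pM ?mul0r.
rewrite qN ?mulr0 //; rewrite !ltnS in ki lj.
rewrite -(ltn_add2l M) (leq_trans ij) // -{1}(subnKC ki) -{1}(subnKC lj).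
by rewrite addnACA leq_add2r.
Qed.

Lemma tdegC (c : F) : tdeg 0 (c%:P)%:P.
Proof. by move=> [|i] [|j] // _; rewrite !coefC //= coefC. Qed.

Lemma tdegX N p k : tdeg N p -> tdeg (N * k) (p ^+ k).
Proof.
move=> pN; elim: k => [|k IHk]; last by rewrite exprS mulnS; exact: tdegM.
by rewrite muln0; exact: tdegC.
Qed.

Lemma tdeg_coef0 N p : tdeg N p -> tdeg N (p`_0)%:P.
Proof. by move=> pN [|i] j ij; rewrite coefC /= ?coef0 // pN. Qed.

(** Every summand of [hlog] is a product of d factors of degree at most N: j + 1 copies of p - p0
    and d - 1 - j copies of p0. *)
Lemma tdeg_hlog N iv d p : tdeg N p -> tdeg (N * d) (hlog (fun j => (iv j)%:P) d p).
Proof.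
move=> pN; rewrite /hlog; elim/big_ind: _ => [|u v uN vN|j _].
- exact: tdeg0.
- exact: tdegD.
have -> : (N * d = 0 + N * j.+1 + N * (d.-1 - j))%N.
  by rewrite add0n -mulnDr subn_predKC.
apply: tdegM; last first.
  by rewrite polyC_exp; apply: tdegX; exact: tdeg_coef0.
apply: tdegM; last by apply/tdegX/tdegD/tdegN/tdeg_coef0.
have -> : (-1) ^+ j * (iv j.+1)%:P = ((-1) ^+ j * iv j.+1)%:P.
  by rewrite polyCM polyC_exp polyCN.
exact: tdegC.
Qed.

End Bidegree.

Section Planes.

Variables (F : fieldType) (n : nat).
Implicit Types (a b v : 'I_n -> F) (p : {mpoly F[n]}).

(* The outer variable is t, the inner one y: p is restricted to a + t b + y v. *)
Definition plane a b v p : {poly {poly F}} :=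
  mmap (polyC \o polyC)
    (fun i => ((a i)%:P + (v i)%:P * 'X)%:P + ((b i)%:P)%:P * 'X) p.

HB.instance Definition _ a b v := GRing.RMorphism.copy (plane a b v)
  (mmap (polyC \o polyC)
    (fun i => ((a i)%:P + (v i)%:P * 'X)%:P + ((b i)%:P)%:P * 'X)).

Lemma planeC a b v c : plane a b v c%:MP = (c%:P)%:P.
Proof. by rewrite /plane mmapC. Qed.

Lemma planeX a b v i :
  plane a b v 'X_i = ((a i)%:P + (v i)%:P * 'X)%:P + ((b i)%:P)%:P * 'X.
Proof. by rewrite /plane mmapX mmap1U. Qed.

Lemma plane_coef0 a b v p : (plane a b v p)`_0 = line a v p.
Proof.
rewrite -horner_coef0.
apply: (@mpoly_rmorph_eq _ _ _ (horner_eval 0 \o plane a b v) (line a v)) => [c|i].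
  by rewrite /= planeC /horner_eval hornerC lineC.
by rewrite /= planeX /horner_eval hornerD hornerC hornerM hornerX mulr0 addr0 lineX.
Qed.

Lemma horner_line a v p y : (line a v p).[y] = p.@[fun i => a i + y * v i].
Proof.
apply: (@mpoly_rmorph_eq _ _ _ (horner_eval y \o line a v) (meval _)) => [c|i] /=.
  by rewrite lineC /horner_eval hornerC mevalC.
by rewrite lineX /horner_eval !hornerE mevalXU [y * _]mulrC.
Qed.

Lemma horner_plane a b v p t y :
  (plane a b v p).[t%:P].[y] = p.@[fun i => a i + t * b i + y * v i].
Proof.
apply: (@mpoly_rmorph_eq _ _ _
  (horner_eval y \o (horner_eval t%:P \o plane a b v)) (meval _)) => [c|i] /=.
  by rewrite planeC /horner_eval !hornerC mevalC.
rewrite planeX /horner_eval !(hornerD, hornerM, hornerC, hornerX) mevalXU.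
by rewrite addrAC [y * _]mulrC [t * _]mulrC.
Qed.

Lemma tdeg_plane a b v p N : (msize p <= N.+1)%N -> tdeg N (plane a b v p).
Proof.
move=> sp; rewrite /plane /mmap big_seq; elim/big_ind: _ => [|u w uN wN|m mp].
- exact: tdeg0.
- exact: tdegD.
apply: (@tdeg_leq _ (0 + mdeg m)).
  by rewrite add0n -ltnS (leq_trans _ sp) // msize_mdeg_lt.
apply: tdegM; first exact: tdegC.
rewrite /mmap1 mdegE; elim/big_rec2: _ => [|i k w _ IH]; first exact: tdegC.
apply: tdegM => //; rewrite -[X in tdeg X]mul1n; apply: tdegX; apply: tdegD.
  move=> [|k'] [|[|j]] // _; rewrite coefC //= ?coef0 //.
  by rewrite coefD coefC coefCM coefX mulr0 addr0.
move=> [|[|k']] j //= ij; rewrite coefCM coefX ?mulr0 ?coef0 //= mulr1 coefC.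
by case: j ij.
Qed.

End Planes.

Section Core.

Variable F : fieldType.
Hypothesis F_char0 : [pchar F] =i pred0.

Let iv (j : nat) : F := j%:R^-1.
Let iv2 (j : nat) : {poly F} := (iv j)%:P.

Let ivP j : iv j.+1 * j.+1%:R = 1.
Proof. by rewrite mulVf //; have /pcharf0P -> := F_char0. Qed.

Let iv2P j : iv2 j.+1 * j.+1%:R = 1.
Proof. by rewrite -polyC_natr -polyCM ivP. Qed.

Variables (f0 g0 : {poly F}) (d e : nat).
Hypotheses (d_gt0 : (0 < d)%N) (sf0 : size f0 = d.+1).
Hypotheses (f00 : f0.[0] != 0) (cop : coprimep f0 g0).

Let W := f0 ^+ (d * e.+1).

Let f0_neq0 : f0 != 0.
Proof. by rewrite -size_poly_eq0 sf0. Qed.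

Let sizeX k : size (f0 ^+ k) = (d * k).+1.
Proof.
have := size_exp f0 k; rewrite sf0 /= => <-.
by rewrite prednK // size_poly_gt0 expf_neq0.
Qed.

(** Partial fractions: [y] inverts g0^d modulo W, so [N * y] reduced modulo W is the numerator over
    W in the decomposition of N / (W g0^d). The functional evaluates that fraction at 0. *)
Lemma factor_functional : exists lam : {poly F} -> F,
  [/\ scalar lam, forall M, lam (W * M) = 0 &
      forall M : {poly F}, (size M <= d * (d * e.+1))%N ->
        lam (g0 ^+ d * M) = M.[0] / f0.[0] ^+ (d * e.+1)].
Proof.
have /Bezout_eq1_coprimepP[[x y] /= E] : coprimep W (g0 ^+ d).
  by apply: coprimep_expl; exact: coprimep_expr.
exists (fun N => ((N * y) %% W).[0] / W.[0]); split=> [c p q|M|M sM].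
- rewrite mulrDl -scalerAl modpD modpZl hornerD hornerZ.
  by rewrite mulrDl mulrA.
- by rewrite -mulrA modp_mulr horner0 mul0r.
rewrite -horner_exp -/W.
have -> : g0 ^+ d * M * y = (- x * M) * W + M.
  have -> : g0 ^+ d * M * y = (y * g0 ^+ d) * M by ring.
  by rewrite -(addKr (x * W) (y * g0 ^+ d)) E; ring.
by rewrite modpD modp_mull add0r modp_small // sizeX.
Qed.

Variable lam : {poly F} -> F.
Hypothesis lam_lin : scalar lam.
Hypothesis lam_f : forall M, lam (W * M) = 0.
Hypothesis lam_g : forall M : {poly F}, (size M <= d * (d * e.+1))%N ->
  lam (g0 ^+ d * M) = M.[0] / f0.[0] ^+ (d * e.+1).

Variables fh gh : {poly {poly F}}.
Hypotheses (fh0 : fh`_0 = f0) (gh0 : gh`_0 = g0).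
Hypothesis fhS : forall i, (0 < i)%N -> (size (fh`_i)%R <= d)%N.

(** [H] is log P with denominators cleared, [L] applies the functional to its coefficients in t, and
    [u] stands for f(a + t b) / f(a), whose logarithm [L] is to recover. *)
Let H := hlog iv2 d (fh ^+ e.+1 * gh).
Let L := e.+1%:R^-1 *: map_poly lam H.
Let u := f0.[0]^-1 *: map_poly (horner_eval 0) fh.

(** The coefficients of positive powers of t in [fh] have y-degree below d, so the j-th summand has
    y-degree at most (d-1)(j+1) + d(d-1-j) < d^2. This strict bound lets [lam_g] apply in
    [factor_log]. *)
Let size_hlog i : (size ((hlog iv2 d fh)`_i)%R <= d * d)%N.
Proof.
have dd : (0 < d * d)%N by rewrite muln_gt0 d_gt0.
rewrite -(prednK dd); move: i.
rewrite /hlog; elim/big_ind: _ => [i|p q pN qN i|j _].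
- by rewrite coef0 size_poly0.
- by rewrite coefD (leq_trans (size_polyD _ _)) // geq_max pN qN.
have jd := ltn_ord j.
have le_N : (0 + d.-1 * j.+1 + d * (d.-1 - j) <= (d * d).-1)%N.
  rewrite add0n -ltnS (prednK dd).
  rewrite -[X in (_ < _ * X)%N](subn_predKC jd) mulnDr ltn_add2r ltn_pmul2r // prednK //.
rewrite fh0 => i.
suff Hy : ydeg (0 + d.-1 * j.+1 + d * (d.-1 - j))
    (((-1) ^+ j * iv2 j.+1)%:P * (fh - f0%:P) ^+ j.+1 * (f0 ^+ (d.-1 - j))%:P).
  by apply: leq_trans (Hy i) _; rewrite ltnS.
apply: ydegM; last by apply: ydegC; rewrite sizeX.
apply: ydegM.
  apply: ydegC; have -> : (-1) ^+ j * iv2 j.+1 = ((-1) ^+ j * iv j.+1)%:P.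
    by rewrite polyCM polyC_exp polyCN.
  exact: size_polyC_leq1.
apply: ydegX => -[|k]; rewrite coefB coefC /=.
  by rewrite fh0 subrr size_poly0.
by rewrite subr0 prednK // fhS.
Qed.

(** By [hlogM] and [hlogX], [H] is g0^d (e+1) f0^(d e) log f plus a multiple of W, logarithms being
    cleared of denominators. The functional kills the second term and evaluates the first at y = 0,
    divided by f0(0)^(d(e+1)); this leaves (e+1) log u. *)
Lemma factor_log : Xdvd d.+1 (L - hlog iv d u).
Proof.
have cu : map_poly (horner_eval 0) fh = f0.[0] *: u.
  by rewrite /u scalerA mulfV // scale1r.
have hl : map_poly (horner_eval 0) (hlog iv2 d fh) = f0.[0] ^+ d *: hlog iv d u.
  rewrite -hlog_scale -cu; apply/esym/hlog_map => j.
  by rewrite /= /horner_eval hornerC.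
have fX0 : (fh ^+ e.+1)`_0 = f0 ^+ e.+1.
  by rewrite -!horner_coef0 horner_exp horner_coef0 fh0.
have nz : e.+1%:R != 0 :> F by have /pcharf0P -> := F_char0.
have c0 k : f0.[0] ^+ k != 0 by rewrite expf_neq0.
have g0_neq0 : g0 != 0.
  apply: contraTneq cop => ->.
  by rewrite coprimep0 -size_poly_eq1 sf0 eqSS -lt0n d_gt0.
have HP : Xdvd d.+1 (H
    - ((g0 ^+ d)%:P * ((e.+1%:R * f0 ^+ (d * e))%:P * hlog iv2 d fh)
       + W%:P * hlog iv2 d gh)).
  have f'0 : fh`_0 != 0 by rewrite fh0.
  have := hlogX iv2P d e f'0; rewrite fh0 => HX.
  have := @hlogM _ _ iv2P d (fh ^+ e.+1) gh.
  rewrite fX0 gh0 expf_neq0 // g0_neq0 => /(_ isT isT) HM.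
  have := XdvdD HM (XdvdMl (g0 ^+ d)%:P HX); congr (Xdvd _ _).
  rewrite /H /W -exprM [(e.+1 * d)%N]mulnC; ring.
apply/XdvdP => i id; have /XdvdP/(_ i id)/eqP := HP.
rewrite coefB coefD !coefCM subr_eq0 => /eqP Hi.
apply/eqP; rewrite coefB subr_eq0 coefZ coef_map_id0 ?functional0 //.
rewrite Hi functionalD // lam_f addr0.
have := congr1 (fun q : {poly F} => q`_i) hl.
rewrite coef_map coefZ /= /horner_eval => hi.
rewrite lam_g; last first.
  rewrite -mulrA -polyC_natr mul_polyC (leq_trans (size_scale_leq _ _)) //.
  rewrite (leq_trans (size_polyMleq _ _)) // sizeX /= mulnS mulnDr addnC.
  by rewrite leq_add2r size_hlog.
rewrite !hornerM horner_exp -polyC_natr hornerC hi mulnS exprD.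
move: (e.+1%:R : F) nz (c0 (d * e)%N) (c0 d) => x nz cde cd.
by apply/eqP; field; rewrite cde cd nz.
Qed.

Lemma factor_exp i : (i <= d)%N -> u`_i = (hexp iv d L)`_i.
Proof.
move=> id; apply/esym/eqP; rewrite -subr_eq0 -coefB.
have u0 : u`_0 = 1 by rewrite coefZ coef_map /= fh0 /horner_eval mulVf.
by have /XdvdP -> := hexp_hlog ivP u0 factor_log.
Qed.

End Core.

(** * An explicit formula for the factor *)

Lemma irreducible_multiplicity (F : fieldType) n (P f : {mpoly F[n]}) :
  P != 0 -> irreducible_elt f -> edvd f P ->
  exists e g, P = f ^+ e.+1 * g /\ ~ edvd f g.
Proof.
move=> + fi; have [f0 fu _] := fi.
have [k] := ubnP (msize P); elim: k P => // k IHk P sP P0 [g Eg].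
have g0 : g != 0 by apply: contraNneq P0 => g0; rewrite Eg g0 mulr0.
have [fg|fg] := classic (edvd f g); last by exists 0%N, g.
have [|e [h [Eh fh]]] := IHk g _ g0 fg; last first.
  by exists e.+1, h; rewrite Eg Eh mulrA -exprS.
rewrite -ltnS (leq_trans _ sP) // ltnS Eg msizeM //.
move: fu; rewrite mpoly_unit_msize // -ltnNge.
by case: (mmeasure mdeg f) => // -[] // l _; rewrite addSn /= addSn ltnS leq_addl.
Qed.

(** All constants are chosen before [b], so this amounts to a polynomial identity in b. The sum over
    k interpolates the functional in y, the sum over j is the logarithm, the sum over l the
    exponential, and the sum over t interpolates the truncation in t. *)
Lemma factor_formula (F : fieldType) n (P f : {mpoly F[n]}) r d :
  [pchar F] =i pred0 -> P != 0 -> msize P = r.+1 ->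
  irreducible_elt f -> edvd f P -> msize f = d.+1 ->
  exists (a v : 'I_n -> F) (w kap c : nat -> F) (nu : nat -> nat -> F),
  forall b, f.@[fun i => a i + b i] =
    \sum_(t < (d * (r * d)).+1) w t * \sum_(l < d.+1) kap l *
      (\sum_(k < (r * d).+1) \sum_(j < d) nu k j *
        (P.@[fun i => a i + t%:R * b i + k%:R * v i] - c k) ^+ j.+1) ^+ l.
Proof.
move=> F0 P0 sP fi fP sf; have [f0 fu _] := fi.
have d_gt0 : (0 < d)%N.
  by rewrite lt0n; apply: contra fu => /eqP d0; rewrite mpoly_unit_msize ?sf ?d0.
have [e [g [EP fg]]] := irreducible_multiplicity P0 fi fP.
have [a [v [fa sl cop]]] := generic_line F0 fi sf fg.
have lf0 : (line a v f).[0] = f.@[a].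
  by rewrite horner_line; apply: meval_eq => i; rewrite mul0r addr0.
have fl0 : (line a v f).[0] != 0 by rewrite lf0.
have [lam [lam_lin lam_f lam_g]] := factor_functional e sl cop.
have [nu nuP] := interpolation lam_lin (r * d) F0.
(* [hexp iv d L] agrees with f(a + t b) / f(a) only up to t^d. Adding its first d + 1 coefficients
   truncates it and sets t = 1. *)
pose coefsum (q : {poly F}) := \sum_(i < d.+1) q`_i.
have coefsum_lin : scalar coefsum.
  move=> c p q; rewrite /coefsum big_distrr -big_split /=; apply: eq_bigr => i _.
  by rewrite coefD coefZ.
have [w wP] := interpolation coefsum_lin (d * (r * d)) F0.
pose iv (j : nat) : F := j%:R^-1.
pose c k := (line a v P).[k%:R].
exists a, v, (fun t => f.@[a] * w t), (ifact iv), c,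
  (fun k j => e.+1%:R^-1 * nu k * ((-1) ^+ j * iv j.+1) * c k ^+ (d.-1 - j)) => b.
pose fh := plane a b v f; pose gh := plane a b v g; pose Ph := plane a b v P.
have EPh : fh ^+ e.+1 * gh = Ph by rewrite /fh /gh -rmorphXn -rmorphM -EP.
have tP : tdeg r Ph by apply: tdeg_plane; rewrite sP.
have tf : tdeg d fh by apply: tdeg_plane; rewrite sf.
pose H := hlog (fun j => (iv j)%:P) d Ph.
have tH : tdeg (r * d) H by exact: tdeg_hlog.
pose L := e.+1%:R^-1 *: map_poly lam H.
have sL : (size L <= (r * d).+1)%N.
  apply/leq_sizeP => i ri; rewrite coefZ coef_map_id0 ?(functional0 lam_lin) //.
  have -> : H`_i = 0; last by rewrite (functional0 lam_lin) mulr0.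
  by apply/polyP => j; rewrite coef0 tH // (leq_trans ri) // leq_addr.
have HL t : L.[t%:R] = \sum_(k < (r * d).+1) \sum_(j < d)
    (e.+1%:R^-1 * nu k * ((-1) ^+ j * iv j.+1) * c k ^+ (d.-1 - j)) *
    (P.@[fun i => a i + t%:R * b i + k%:R * v i] - c k) ^+ j.+1.
  (* [lam] acts on y and is linear, so it commutes with specializing the outer variable to a
     constant. *)
  have -> : L.[t%:R] = e.+1%:R^-1 * lam H.[(t%:R)%:P].
    rewrite hornerZ; congr (_ * _); rewrite [in RHS]horner_coef (functional_sum lam_lin).
    rewrite (@horner_coef_wide _ (size H)) ?size_poly //.
    apply: eq_bigr => i _; rewrite coef_map_id0 ?(functional0 lam_lin) //.
    by rewrite -polyC_exp mulrC -(functionalZ lam_lin) -mul_polyC mulrC.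
  rewrite nuP; last first.
    apply/leq_sizeP => j rj; rewrite horner_coef coef_sum big1 // => i _.
    by rewrite -polyC_exp coefMC tH ?mul0r // (leq_trans rj) // leq_addl.
  rewrite big_distrr; apply: eq_bigr => k _ /=.
  rewrite /H /hlog !horner_sum !big_distrr; apply: eq_bigr => j _ /=.
  rewrite plane_coef0 !(hornerM, horner_exp, hornerC, hornerD, hornerN).
  rewrite horner_plane -/(c k); ring.
pose u := (line a v f).[0]^-1 *: map_poly (horner_eval 0) fh.
have uE i : (i <= d)%N -> u`_i = (hexp iv d L)`_i.
  have := @factor_exp F F0 _ _ d e d_gt0 sl fl0 cop lam lam_lin lam_f lam_g fh gh.
  rewrite EPh; apply.
  - exact: plane_coef0.
  - exact: plane_coef0.
  - move=> j j0; apply/leq_sizeP => k dk; apply: tf.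
    by rewrite -[d]add0n -addSn leq_add.
have -> : f.@[fun i => a i + b i] = f.@[a] * coefsum (hexp iv d L).
  have -> : f.@[fun i => a i + b i] = (map_poly (horner_eval 0) fh).[1].
    transitivity (fh.[1%:P].[0]).
      by rewrite horner_plane; apply: meval_eq => i; rewrite mul1r mul0r addr0.
    by rewrite -[1 in RHS](hornerC 1 0) -/(horner_eval 0 _) horner_map.
  have -> : map_poly (horner_eval 0) fh = f.@[a] *: u.
    by rewrite /u lf0 scalerA mulfV // scale1r.
  rewrite hornerZ; congr (_ * _); rewrite (@horner_coef_wide _ d.+1).
    by apply: eq_bigr => i _; rewrite expr1n mulr1 uE // -ltnS.
  apply/leq_sizeP => i di; rewrite coefZ coef_map.
  have -> : fh`_i = 0; last by rewrite /= /horner_eval horner0 mulr0.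
  by apply/polyP => j; rewrite coef0 tf // (leq_trans di) // leq_addr.
rewrite wP; last first.
  rewrite /hexp; elim/big_ind: _ => [|p q sp sq|l _].
  - by rewrite size_poly0.
  - by rewrite (leq_trans (size_polyD _ _)) // geq_max sp.
  rewrite mul_polyC (leq_trans (size_scale_leq _ _)) //.
  apply: leq_trans (size_poly_exp_leq _ _) _; rewrite ltnS mulnC.
  by apply: leq_mul; [rewrite -ltnS | rewrite -subn1 leq_subLR add1n].
rewrite big_distrr; apply: eq_bigr => t _ /=; rewrite mulrA; congr (_ * _).
rewrite /hexp horner_sum; apply: eq_bigr => l _.
by rewrite hornerM hornerC horner_exp HL.
Qed.

(** * Size accounting and conclusion *)

Definition size_bound (s r d n : nat) : nat :=
  let inner := (d * (d * (s + 4 * n + 2 + 2) + 2 + 2 + 2))%N in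
  let outer := (d.+1 * (d * ((r * d).+1 * (inner + 2) + 2) + 2 + 2 + 2))%N in
  ((d * (r * d)).+1 * (outer + 2 + 2))%N.

(** The same expression over any ring, so that it can be read both as a polynomial over [int] and as
    its value. *)
Definition size_bound_poly (R : pzRingType) (s r d n : R) : R :=
  let inner := d * (d * (s + 4%:R * n + 2%:R + 2%:R) + 2%:R + 2%:R + 2%:R) in
  let outer :=
    (d + 1) * (d * ((r * d + 1) * (inner + 2%:R) + 2%:R) + 2%:R + 2%:R + 2%:R) in
  (d * (r * d) + 1) * (outer + 2%:R + 2%:R).

Lemma size_bound_natr (R : pzRingType) s r d n :
  (size_bound s r d n)%:R = size_bound_poly s%:R r%:R d%:R n%:R :> R.
Proof.
by rewrite /size_bound /size_bound_poly -!natr1 !(natrM, natrD) -!natr1 !natrM.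
Qed.

Lemma size_bound_rmorph (R S : pzRingType) (phi : {rmorphism R -> S}) s r d n :
  phi (size_bound_poly s r d n) =
  size_bound_poly (phi s) (phi r) (phi d) (phi n).
Proof. by rewrite /size_bound_poly !(rmorphD, rmorphM, rmorph_nat, rmorph1). Qed.

Lemma vsum_factor (F : fieldType) n (P f : {mpoly F[n]}) m s r d :
  [pchar F] =i pred0 -> P != 0 -> msize P = r.+1 -> vsum m s P ->
  irreducible_elt f -> edvd f P -> msize f = d.+1 ->
  vsum (d * (d * m)) (size_bound s r d n) f.
Proof.
move=> F0 P0 sP Ps fi fP sf.
have [a [v [w [kap [c [nu fE]]]]]] := factor_formula F0 P0 sP fi fP sf.
(* Putting b = x - a in the formula turns its argument a + t b + k v into t x + (a - t a + k v). *)
pose A (t k : nat) :=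
  [tuple (t%:R)%:MP * 'X_i + (a i - t%:R * a i + k%:R * v i)%:MP | i < n].
have -> : f = \sum_(t < (d * (r * d)).+1) (w t)%:MP *
    \sum_(l < d.+1) (kap l)%:MP *
      (\sum_(k < (r * d).+1) \sum_(j < d) (nu k j)%:MP *
        (P \mPo A t k + (- c k)%:MP) ^+ j.+1) ^+ l.
  apply: (mpoly_eq_meval F0) => x.
  have -> : f.@[x] = f.@[fun i => a i + (x i - a i)].
    by apply: meval_eq => i; rewrite addrC subrK.
  rewrite fE !raddf_sum; apply: eq_bigr => t _ /=.
  rewrite mevalM mevalC; congr (_ * _); rewrite raddf_sum; apply: eq_bigr => l _ /=.
  rewrite mevalM mevalC rmorphXn /=; congr (_ * _ ^+ _).
  rewrite raddf_sum; apply: eq_bigr => k _ /=.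
  rewrite raddf_sum; apply: eq_bigr => j _ /=.
  rewrite mevalM mevalC rmorphXn /= mevalD mevalC comp_mpoly_meval.
  congr (_ * (_ - _) ^+ _); apply: meval_eq => i.
  by rewrite tnth_mktuple mevalD mevalM !mevalC mevalXU; ring.
apply: vsum_sum => // t; apply: vsumZ => //.
apply: vsum_sum => // l; apply: vsumZ => //.
apply: (@vsum_leq _ _ _
  (l * ((r * d).+1 * (d * (d * (s + 4 * n + 2 + 2) + 2 + 2 + 2) + 2) + 2) + 2)).
  by rewrite leq_add2r leq_mul // -ltnS.
(* The powers have varying numbers of bits; each is padded to the count for exponent d, so that the
   summands can be added. *)
apply: (@vsum_pad _ _ F0 (l * (d * m))); first by rewrite leq_mul // -ltnS.
apply: vsumX => //; apply: vsum_sum => // k; apply: vsum_sum => // j.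
apply: vsumZ => //.
apply: (@vsum_leq _ _ _ (j.+1 * (s + 4 * n + 2 + 2) + 2)).
  by rewrite leq_add2r leq_mul.
apply: (@vsum_pad _ _ F0 (j.+1 * m)); first by rewrite leq_mul.
apply: vsumX => //.
apply: (@vsum_leq _ _ _ (s + 4 * n + 0 + 2)); first by rewrite addn0.
by apply: vsumD; [exact: vsum_affine | exact: vsumC].
Qed.

Theorem theorem2p8 :
  exists poly : {mpoly int[5]},
  forall (F : fieldType) (n m s r d : nat)
         (P : {mpoly F[n]}) (Q : {mpoly F[n + m]}) (f : {mpoly F[n]}),
    [pchar F] =i pred0 ->
    P != 0 -> msize P = r.+1 ->
    P = \sum_(y : {ffun 'I_m -> bool}) subst_bits Q y ->
    (exists2 C : circuit F (n + m), computes C Q & circuit_size C = s) ->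
    irreducible_elt f -> (exists g : {mpoly F[n]}, P = f * g) ->
    msize f = d.+1 ->
    let bound := poly.@[tnth [tuple s%:Z; r%:Z; d%:Z; n%:Z; m%:Z]] in
    exists m' s' : nat,
      [/\ m'%:Z <= bound, s'%:Z <= bound
        & exists h : {mpoly F[n + m']},
            (exists2 C : circuit F (n + m'),
               computes C h & (circuit_size C <= s')%N)
            /\ f = \sum_(z : {ffun 'I_m' -> bool}) subst_bits h z].
Proof.
pose x (k : 'I_5) : {mpoly int[5]} := 'X_k.
pose B : {mpoly int[5]} := size_bound_poly (x 0) (x 1) (x 2%R) (x 3%R).
(* The bit count d d m plus the size bound, so that one polynomial dominates both. *)
exists (x 2%R * (x 2%R * x 4%R) + B).
move=> F n m s r d P Q f F0 P0 sP PQ [C CQ Cs] fi fP sf.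
have Ps : vsum m s P by exists Q => //; exists C => //; rewrite Cs.
have [h [D Dh Ds] Ef] := vsum_factor F0 P0 sP Ps fi fP sf.
move=> bound.
have -> : bound = (d * (d * m) + size_bound s r d n)%:Z.
  rewrite /bound mevalD (size_bound_rmorph (meval _)) /= !mevalM !mevalXU.
  by rewrite PoszD -[Posz (size_bound _ _ _ _)]natz size_bound_natr !natz !PoszM.
exists (d * (d * m))%N, (size_bound s r d n); split.
- by rewrite lez_nat leq_addr.
- by rewrite lez_nat leq_addl.
by exists h; split=> //; exists D.
Qed.
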